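(* Let $n,m,l\in\mathbb{N}$, let $\Phi:\mathbb{M}_n\to\mathbb{M}_l$ and $\Psi:\mathbb{M}_m\to\mathbb{M}_l$ be strictly positive linear maps that are completely positive, let $-1\le p\le0$, and let $f$ be a non-decreasing concave function on $(0,\infty)$ with $\lim_{x\to\infty}f(x)/x=0$ such that $x\mapsto f(x^{2+p})$ is convex on $(0,\infty)$. Then $$(A,B)\in\mathbb{P}_n\times\mathbb{P}_m\longmapsto\mathrm{Tr}\, f\bigl(\Phi(A^p)^{1/2}\Psi(B^2)\Phi(A^p)^{1/2}\bigr)$$ is jointly convex.
   Context: $\mathbb{M}_n$: $n\times n$ complex matrices; $\mathbb{P}_n$: positive definite ones; $\mathrm{Tr}$: usual trace. A linear map is strictly positive if it maps positive definite matrices to positive definite matrices. *)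

(* Defs.v *)
(* mathcomp algebra (spectral, sesquilinear), real_closed
   complex numbers R[i], and mathcomp-analysis (powR, limits). *)
From mathcomp Require Import all_boot all_order all_algebra.
From mathcomp Require Import complex.
From mathcomp Require Import all_classical all_reals all_analysis.

Set Implicit Arguments.
Unset Strict Implicit.
Unset Printing Implicit Defensive.

Import Order.TTheory GRing.Theory Num.Theory.
Import numFieldNormedType.Exports.
Local Open Scope ring_scope.
Local Open Scope sesquilinear_scope.

(* the embedding of a real into R[i] *)
Definition RtoC (R : rcfType) (x : R) : R[i] := Complex x 0.

(* x^* A x, i.e. the quadratic form v A v^* for a row vector v. *)
Definition qform (C : numClosedFieldType) n (A : 'M[C]_n) (v : 'rV[C]_n) : C :=
  (v *m A *m v ^t*) 0 0.

(* positive definite matrices P_n *)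
Definition posdefmx (C : numClosedFieldType) n (A : 'M[C]_n) : Prop :=
  forall v : 'rV[C]_n, v != 0 -> 0 < qform A v.

(* positive semidefinite matrices *)
Definition psdmx (C : numClosedFieldType) n (A : 'M[C]_n) : Prop :=
  forall v : 'rV[C]_n, 0 <= qform A v.

(* strictly positive: maps positive definite matrices to positive definite *)
Definition strictly_positive (C : numClosedFieldType) n l
  (Phi : 'M[C]_n -> 'M[C]_l) : Prop :=
  forall A : 'M[C]_n, posdefmx A -> posdefmx (Phi A).

(* completely positive: for every k, id_{M_k} (x) Phi maps positive
   semidefinite elements of M_k(M_n) (k x k block matrices with n x n blocks)
   to positive semidefinite elements of M_k(M_l). *)
Definition completely_positive (C : numClosedFieldType) n l
  (Phi : 'M[C]_n -> 'M[C]_l) : Prop :=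
  forall (k : nat) (X : 'I_k -> 'I_k -> 'M[C]_n),
    psdmx (\mxblock_(i < k, j < k) X i j) ->
    psdmx (\mxblock_(i < k, j < k) Phi (X i j)).

(* Functional calculus for a normal (in particular Hermitian) matrix
   A = U^-1 diag(lambda) U (spectral decomposition from mathcomp's spectral.v):
   g(A) := U^-1 diag(g(Re lambda)) U, for a real function g. *)
Definition mxfun (R : rcfType) n (g : R -> R) (A : 'M[R[i]]_n) : 'M[R[i]]_n :=
  invmx (spectralmx A) *m
  diag_mx (map_mx (fun z : R[i] => RtoC (g (complex.Re z))) (spectral_diag A))
  *m spectralmx A.

(* The function of the theorem:
   (A,B) |-> Tr f(Phi(A^p)^{1/2} Psi(B^2) Phi(A^p)^{1/2}) (real-valued). *)
Definition trace_fun (R : realType) n m l (f : R -> R) (p : R)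
  (Phi : 'M[R[i]]_n -> 'M[R[i]]_l) (Psi : 'M[R[i]]_m -> 'M[R[i]]_l)
  (A : 'M[R[i]]_n) (B : 'M[R[i]]_m) : R :=
  let S := mxfun (fun x => Num.sqrt x) (Phi (mxfun (fun x => x `^ p) A)) in
  complex.Re (\tr (mxfun f (S *m Psi (B *m B) *m S))).

(* Main.v *)
(**
Write C = Phi(A^p) and D = Psi(B^2). If f is constant there is nothing to prove,
and for p = -1 the hypotheses force f to be constant. Otherwise the trace function
is unfolded by three scalar Legendre-type dualities, each lifted to traces by the
joint spectral decomposition of two matrices:
- Tr f(C^1/2 D C^1/2) = inf_Z (Tr D Z^-1 + Tr h(C^1/2 Z C^1/2)), where
  h x = sup_s (f s - s / x) and w |-> h(w^(1+p)) is convex;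
- Tr h(C^1/2 Z C^1/2) = sup_N (Tr Z N^-1 - Tr m(C^1/2 N C^1/2)), where
  m v = sup_x (x / v - h x) and u |-> - m(u^p) is convex;
- - Tr m(N^1/2 C N^1/2) = inf_Y (Tr N^1/2 C N^1/2 Y^(1-p) + Tr e(Y)), where
  e y = sup_x (- m x - x y^(1-p)) is convex.
For p = 0 the matrix C is constant and h is convex, so only the first is needed.
A supremum of convex functions and a partial infimum of jointly convex functions
are convex, so everything reduces to the joint convexity of Tr K^* A^p K Y^(1-p)
for -1 <= p <= 0 (Lieb, Ando), applied to the Kraus operators of Phi, and of Psi
with p = -1. It follows from the joint concavity of a^r y^(1-r) as a function of
the commuting operators L_A and R_Y, which passes from arithmetic and parallel
sums to geometric means.
*)

Require Import Defs.
From mathcomp Require Import all_boot all_order all_algebra.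
From mathcomp Require Import complex.
From mathcomp Require Import all_classical all_reals all_analysis.
From mathcomp Require Import ring lra.
Import Order.TTheory GRing.Theory Num.Theory.
Import numFieldNormedType.Exports.
Local Open Scope ring_scope.
Local Open Scope classical_set_scope.

Set Implicit Arguments.
Unset Strict Implicit.
Unset Printing Implicit Defensive.

(** * Scalar dualities *)

Definition convex_pos (R : realType) (g : R -> R) : Prop :=
  forall x y t : R, 0 < x -> 0 < y -> 0 <= t <= 1 ->
    g (t * x + (1 - t) * y) <= t * g x + (1 - t) * g y.

Lemma conv_gt0 (R : realType) (x y t : R) :
  0 < x -> 0 < y -> 0 <= t <= 1 -> 0 < t * x + (1 - t) * y.
Proof.
move=> x0 y0 /andP[t0 t1]; have [->|tn0] := eqVneq t 0; first by lra.
have tp : 0 < t by rewrite lt_neqAle eq_sym tn0.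
by rewrite ltr_wpDr ?mulr_gt0 ?mulr_ge0 ?subr_ge0// ltW.
Qed.

(** The point [x] is the convex combination of [y] and [z] with weight [(z - x) / (z - y)] on [y];
    clearing denominators gives the comparison. *)
Lemma convex_pos_slopes (R : realType) (g : R -> R) (x y z : R) :
  convex_pos g -> 0 < y -> y < x -> x < z ->
  (g x - g y) / (x - y) <= (g z - g x) / (z - x).
Proof.
move=> cg y0 yx xz; have z0 : 0 < z by lra.
have zy : z - y != 0 by rewrite subr_eq0 gt_eqF//; lra.
have := cg y z ((z - x) / (z - y)) y0 z0.
have -> : (z - x) / (z - y) * y + (1 - (z - x) / (z - y)) * z = x by field.
have -> : (0 <= (z - x) / (z - y) <= 1).
  by apply/andP; split; [apply: divr_ge0; lra|rewrite ler_pdivrMr; lra].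
move=> /(_ isT) H.
rewrite ler_pdivrMr ?subr_gt0// mulrAC ler_pdivlMr ?subr_gt0//.
have : g x * (z - y) <= (z - x) * g y + (x - y) * g z.
  rewrite -ler_pdivlMr ?subr_gt0//; last lra.
  apply: le_trans H _; rewrite le_eqVlt; apply/orP; left; apply/eqP; field.
  by [].
by nra.
Qed.

Lemma convex_pos_subgradient (R : realType) (g : R -> R) (x : R) :
  convex_pos g -> 0 < x ->
  exists k, forall y, 0 < y -> g x + k * (y - x) <= g y.
Proof.
(* The subgradient is the left derivative: the supremum of the chord slopes on the left of [x],
   bounded by every chord slope on the right. *)
move=> cg x0; pose E := [set (g x - g y) / (x - y) | y in [set y : R | 0 < y < x]].
have E0 : E !=set0.
  by exists ((g x - g (x / 2)) / (x - x / 2)); exists (x / 2) => //=; lra.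
have Eub z : x < z -> ubound E ((g z - g x) / (z - x)).
  by move=> xz _ [y /= /andP[y0 yx] <-]; exact: convex_pos_slopes.
have hE : has_sup E.
  by split => //; exists ((g (x + 1) - g x) / (x + 1 - x)); apply: Eub; lra.
exists (sup E) => y y0; have [yx|xy|->] := ltgtP y x; last by lra.
- have : (g x - g y) / (x - y) <= sup E.
    by apply: ub_le_sup; [case: hE|exists y => //=; rewrite y0].
  by rewrite ler_pdivrMr ?subr_gt0//; nra.
- have : sup E <= (g y - g x) / (y - x) by apply: ge_sup => //; exact: Eub.
  by rewrite ler_pdivlMr ?subr_gt0//; nra.
Qed.

(** On a set that is not bounded above [sup] returns a default value, so the lemmas below that need
    finiteness carry an explicit upper bound [c]. *)
Definition sup_pos (R : realType) (g : R -> R) : R :=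
  sup [set g s | s in [set s : R | 0 < s]].

Lemma sup_pos_ge (R : realType) (g : R -> R) (c s : R) :
  (forall u, 0 < u -> g u <= c) -> 0 < s -> g s <= sup_pos g.
Proof.
move=> gc s0; apply: ub_le_sup; last by exists s.
by exists c => _ [u /= u0 <-]; exact: gc.
Qed.

Lemma sup_pos_le (R : realType) (g : R -> R) (c : R) :
  (forall u, 0 < u -> g u <= c) -> sup_pos g <= c.
Proof.
move=> gc; apply: ge_sup; first by exists (g 1); exists 1 => //=.
by move=> _ [u /= u0 <-]; exact: gc.
Qed.

Lemma sup_pos_adherent (R : realType) (g : R -> R) (c e : R) :
  (forall u, 0 < u -> g u <= c) -> 0 < e ->
  exists2 s, 0 < s & sup_pos g < g s + e.
Proof.
move=> gc e0; have hE : has_sup [set g s | s in [set s : R | 0 < s]].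
  split; first by exists (g 1); exists 1 => //=.
  by exists c => _ [u /= u0 <-]; exact: gc.
have [_ [s /= s0 <-] lt] := sup_adherent e0 hE.
by exists s => //; rewrite /sup_pos; lra.
Qed.

(** Convexity of the exponential between [ln x] and 0, weighted by [a] and [1 - a]. *)
Lemma powR_le_tangent (R : realType) (x a : R) :
  0 < x -> 0 <= a <= 1 -> x `^ a <= a * x + (1 - a).
Proof.
move=> x0 /andP[a0 a1]; rewrite /powR gt_eqF//.
have := @convex_expR R (Itv01 a0 a1) (ln x) 0.
by rewrite !convRE /= expR0 mulr0 addr0 mulr1 lnK.
Qed.

Lemma powR_prod_concave (R : realType) (a t x1 x2 y1 y2 : R) :
  0 <= a <= 1 -> 0 <= t <= 1 -> 0 < x1 -> 0 < x2 -> 0 < y1 -> 0 < y2 ->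
  t * (x1 `^ a * y1 `^ (1 - a)) + (1 - t) * (x2 `^ a * y2 `^ (1 - a)) <=
  (t * x1 + (1 - t) * x2) `^ a * (t * y1 + (1 - t) * y2) `^ (1 - a).
Proof.
move=> a01 t01 x10 x20 y10 y20.
set x := t * x1 + _; set y := t * y1 + _.
have x0 : 0 < x by exact: conv_gt0.
have y0 : 0 < y by exact: conv_gt0.
(* The supporting plane of u^a v^(1-a) at (x, y). By homogeneity it reduces to the tangent
   inequality for [r], the ratio of u/x to v/y. *)
have amgm u v : 0 < u -> 0 < v ->
    u `^ a * v `^ (1 - a) <= x `^ a * y `^ (1 - a) * (a * (u / x) + (1 - a) * (v / y)).
  move=> u0 v0; have w0 : 0 < (u / x) / (v / y) by rewrite !divr_gt0.
  have := powR_le_tangent w0 a01.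
  set r := _ / _ => H.
  have -> : u `^ a * v `^ (1 - a) = x `^ a * y `^ (1 - a) * (v / y) * r `^ a.
    have {1}-> : u = x * (v / y) * r by rewrite /r; field; rewrite !gt_eqF.
    have {2}-> : v = y * (v / y) by field; rewrite !gt_eqF.
    have vy : 0 < v / y by exact: divr_gt0.
    have E : v / y = (v / y) `^ (1 - a) * (v / y) `^ a.
      by rewrite -powRD ?(gt_eqF vy) ?implybT// subrK powRr1// ltW.
    move: (v / y) vy E => q q0 E.
    have r0 : 0 <= r by exact: ltW w0.
    rewrite (powRM _ _ r0) ?mulr_ge0 ?(ltW x0) ?(ltW q0)//.
    rewrite (powRM _ (ltW x0) (ltW q0)) (powRM _ (ltW y0) (ltW q0)).
    by rewrite [X in _ = _ * X * _]E; ring.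
  have -> : a * (u / x) + (1 - a) * (v / y) = (v / y) * (a * r + (1 - a)).
    by rewrite /r; field; rewrite !gt_eqF.
  rewrite [leRHS]mulrA; apply: ler_wpM2l => //.
  by rewrite !mulr_ge0 ?powR_ge0 ?invr_ge0 ?ltW.
have H1 := amgm _ _ x10 y10; have H2 := amgm _ _ x20 y20.
(* The plane touches at (x, y), so averaging its values at the two points returns the value
   there. *)
have -> : x `^ a * y `^ (1 - a) =
   t * (x `^ a * y `^ (1 - a) * (a * (x1 / x) + (1 - a) * (y1 / y))) +
   (1 - t) * (x `^ a * y `^ (1 - a) * (a * (x2 / x) + (1 - a) * (y2 / y))).
  have : a * ((t * x1 + (1 - t) * x2) / x) + (1 - a) * ((t * y1 + (1 - t) * y2) / y) = 1.
    by rewrite !divff ?gt_eqF//; ring.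
  set P := x `^ a * _ => E; rewrite -[LHS]mulr1 -[X in _ * X = _]E; ring.
by move: t01 => /andP[t0 t1]; apply: lerD; apply: ler_wpM2l => //; lra.
Qed.

(** The Legendre conjugate of - f at the slope - 1/x. The parameter is 1/x because the dual variable
    will enter through a matrix inverse. *)
Definition hdual (R : realType) (f : R -> R) (x : R) : R :=
  sup_pos (fun s => f s - s / x).

(** Beyond some [S], f s is below s / x because f(s)/s tends to 0; up to [S], monotonicity bounds f
    by [f S]. *)
Lemma hdual_bound (R : realType) (f : R -> R) (x : R) :
  (forall x y : R, 0 < x -> x <= y -> f x <= f y) ->
  ((fun x => f x / x) @ +oo --> (0 : R)) -> 0 < x ->
  exists c, forall s, 0 < s -> f s - s / x <= c.
Proof.
move=> fm fl x0; have xV0 : 0 < x^-1 by rewrite invr_gt0.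
have /cvgrPdist_lt /(_ _ xV0) [M [_ HM]] := fl.
pose S := Num.max (M + 1) 1.
have S0 : 0 < S by rewrite lt_max ltr01 orbT.
exists (Num.max (f S) 0) => s s0; rewrite le_max; have [sS|Ss] := leP s S.
  have := fm _ _ s0 sS; have : 0 < s / x by exact: divr_gt0.
  by move=> ? ?; apply/orP; left; lra.
apply/orP; right; have Ms : M < s.
  by apply: lt_trans Ss; rewrite lt_max; apply/orP; left; lra.
have := HM _ Ms; rewrite /= sub0r normrN => /ltr_normlW.
by rewrite ltr_pdivrMr// subr_le0 mulrC => /ltW.
Qed.

Lemma hdual_ge (R : realType) (f : R -> R) (s x : R) :
  (forall x y : R, 0 < x -> x <= y -> f x <= f y) ->
  ((fun x => f x / x) @ +oo --> (0 : R)) -> 0 < s -> 0 < x ->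
  f s <= s / x + hdual f x.
Proof.
move=> fm fl s0 x0; have [c hc] := hdual_bound fm fl x0.
by have := sup_pos_ge hc s0; rewrite -/(hdual f x); lra.
Qed.

Lemma concave_supergradient_ge0 (R : realType) (f : R -> R) (s : R) :
  (forall x y : R, 0 < x -> x <= y -> f x <= f y) ->
  convex_pos (fun x => - f x) -> 0 < s ->
  exists2 k, 0 <= k & forall u, 0 < u -> f u <= f s + k * (u - s).
Proof.
move=> fm fc s0; have [k /= hk] := convex_pos_subgradient fc s0.
exists (- k); last by move=> u u0; have := hk u u0; lra.
(* Comparing [s] with [s + 1] shows that the slope is nonnegative. *)
have s10 : 0 < s + 1 by lra.
have s1 : s <= s + 1 by lra.
by have := hk _ s10; have := fm _ _ s0 s1; lra.
Qed.

(** A supergradient k of f at s would be the exact optimal 1/x, but it may vanish; [k + d / s] is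
    positive and costs only [d]. *)
Lemma hdual_attained (R : realType) (f : R -> R) (s d : R) :
  (forall x y : R, 0 < x -> x <= y -> f x <= f y) ->
  convex_pos (fun x => - f x) -> 0 < s -> 0 < d ->
  exists2 x, 0 < x & s / x + hdual f x <= f s + d.
Proof.
move=> fm fc s0 d0; have [k k0 hk] := concave_supergradient_ge0 fm fc s0.
have ds : 0 < d / s by exact: divr_gt0.
exists (k + d / s)^-1; first by rewrite invr_gt0; lra.
rewrite invrK; have : hdual f (k + d / s)^-1 <= f s - k * s.
  apply: sup_pos_le => u u0; rewrite invrK; have := hk u u0.
  have : 0 < d / s * u by exact: mulr_gt0.
  by nra.
have -> : s * (k + d / s) = k * s + d by field; rewrite gt_eqF.
by lra.
Qed.

Lemma hdual_nondecreasing (R : realType) (f : R -> R) (x y : R) :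
  (forall x y : R, 0 < x -> x <= y -> f x <= f y) ->
  ((fun x => f x / x) @ +oo --> (0 : R)) ->
  0 < x -> x <= y -> hdual f x <= hdual f y.
Proof.
move=> fm fl x0 xy; have y0 : 0 < y by lra.
apply: sup_pos_le => s s0; have := hdual_ge fm fl s0 y0.
have : s / y <= s / x by rewrite ler_pM2l// lef_pV2.
by lra.
Qed.

Lemma hdual_nonconstant (R : realType) (f : R -> R) (s1 s2 : R) :
  (forall x y : R, 0 < x -> x <= y -> f x <= f y) ->
  convex_pos (fun x => - f x) ->
  ((fun x => f x / x) @ +oo --> (0 : R)) ->
  0 < s1 -> 0 < s2 -> f s1 < f s2 ->
  exists x y, [/\ 0 < x, 0 < y & hdual f x < hdual f y].
Proof.
move=> fm fc fl s10 s20 f12.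
have d0 : 0 < (f s2 - f s1) / 2 by lra.
have [x x0 hx] := hdual_attained fm fc s10 d0.
(* This [y] makes s2 / y a quarter of the gap f s2 - f s1, while [hdual f x] exceeds f s1 by less
   than half of the gap. *)
have y0 : 0 < 4 * s2 / (f s2 - f s1) by rewrite divr_gt0; lra.
exists x, (4 * s2 / (f s2 - f s1)); split => //.
have := hdual_ge fm fl s20 y0.
have -> : s2 / (4 * s2 / (f s2 - f s1)) = (f s2 - f s1) / 4.
  by field; rewrite subr_eq0 !gt_eqF.
have : 0 < s1 / x by exact: divr_gt0.
by lra.
Qed.

(* The substitution s = (w v)^(2+p) turns s / w^(1+p) into w v^(2+p), linear in w. *)
Lemma hdual_powR_convex (R : realType) (f : R -> R) (p : R) :
  -1 < p <= 0 ->
  (forall x y : R, 0 < x -> x <= y -> f x <= f y) ->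
  ((fun x => f x / x) @ +oo --> (0 : R)) ->
  convex_pos (fun x => f (x `^ (2 + p))) ->
  convex_pos (fun w => hdual f (w `^ (1 + p))).
Proof.
move=> /andP[p1 p0] fm fl fg w1 w2 t w10 w20 t01.
set w := t * w1 + _; have w0 : 0 < w by exact: conv_gt0.
apply: sup_pos_le => s s0.
have [v v0 ->] : exists2 v, 0 < v & s = (w * v) `^ (2 + p).
  exists (s `^ (2 + p)^-1 / w); first by rewrite divr_gt0 ?powR_gt0.
  have p2 : 2 + p != 0 by rewrite gt_eqF//; lra.
  by rewrite mulrC divfK ?gt_eqF// -powRrM mulVf// powRr1// ltW.
have lin z : 0 < z -> (z * v) `^ (2 + p) / z `^ (1 + p) = z * v `^ (2 + p).
  move=> z0; rewrite powRM ?ltW// mulrAC; congr (_ * _).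
  rewrite -powRB ?(gt_eqF z0) ?implybT//.
  by rewrite (_ : 2 + p - (1 + p) = 1) ?powRr1 ?ltW//; ring.
rewrite lin//.
have up z : 0 < z -> f ((z * v) `^ (2 + p)) <= z * v `^ (2 + p) + hdual f (z `^ (1 + p)).
  by move=> z0; rewrite -lin//; apply: hdual_ge; rewrite ?powR_gt0// mulr_gt0.
have := fg (w1 * v) (w2 * v) t (mulr_gt0 w10 v0) (mulr_gt0 w20 v0) t01.
rewrite /= !mulrA -mulrDl -/w.
move: (up _ w10) (up _ w20); move: t01 => /andP[t0 t1] H1 H2 H3.
have t1' : 0 <= 1 - t by lra.
have := ler_wpM2l t0 H1; have := ler_wpM2l t1' H2.
have -> : w * v `^ (2 + p) = t * (w1 * v `^ (2 + p)) + (1 - t) * (w2 * v `^ (2 + p)).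
  by rewrite /w; ring.
by lra.
Qed.

(** The convex function s^(1/a) lies above its tangent at w^a, whose slope is w^(1-a)/a. *)
Lemma powR_chord (R : realType) (a w w' : R) :
  0 < a <= 1 -> 0 < w -> 0 < w' ->
  w + (w' `^ a - w `^ a) * (w `^ (1 - a) / a) <= w'.
Proof.
move=> /andP[a0 a1] w0 w'0.
have a01 : 0 <= a <= 1 by rewrite ltW.
have wa0 := powR_gt0 a w0.
have H : w' `^ a <= (a * (w' / w) + (1 - a)) * w `^ a.
  rewrite -{1}(divfK (lt0r_neq0 w0) w') (powRM _ (ltW (divr_gt0 w'0 w0)) (ltW w0)) ler_pM2r//.
  by apply: powR_le_tangent; rewrite ?divr_gt0.
have -> : w `^ (1 - a) = w / w `^ a.
  by rewrite powRB ?(gt_eqF w0) ?implybT// powRr1 ?ltW.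
rewrite -lerBrDl mulrA ler_pdivrMr// mulrA ler_pdivrMr//.
have -> : (w' - w) * a * w `^ a = w * ((a * (w' / w) + (1 - a)) * w `^ a - w `^ a).
  by field; rewrite gt_eqF.
by rewrite mulrC ler_pM2l// lerD2r.
Qed.

(** Here h is the convex function w -> h(w^a) after the convex root y^(1/a). Monotonicity makes the
    outer slope [k] nonnegative, so multiplying it by the slope of the root keeps the inequality. *)
Lemma convex_powR_subgradient (R : realType) (h : R -> R) (a x : R) :
  0 < a <= 1 -> (forall x y : R, 0 < x -> x <= y -> h x <= h y) ->
  convex_pos (fun w => h (w `^ a)) -> 0 < x ->
  exists2 k, 0 <= k & forall y, 0 < y -> h x + k * (y - x) <= h y.
Proof.
move=> a01 hm hc x0; have a0 : 0 < a by case/andP: a01.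
have rootK z : 0 < z -> (z `^ a^-1) `^ a = z.
  by move=> z0; rewrite -powRrM mulVf ?gt_eqF// powRr1// ltW.
set w := x `^ a^-1; have w0 : 0 < w by exact: powR_gt0.
have [k /= hk] := convex_pos_subgradient hc w0.
have k0 : 0 <= k.
  have w20 : 0 < w / 2 by lra.
  have := hk _ w20; have : h ((w / 2) `^ a) <= h (w `^ a).
    apply: hm; first exact: powR_gt0.
    by apply: ge0_ler_powR; rewrite ?nnegrE; lra.
  by move=> ? ?; nra.
exists (k * (w `^ (1 - a) / a)).
  by rewrite mulr_ge0// divr_ge0 ?powR_ge0// ltW.
move=> y y0; have w'0 : 0 < y `^ a^-1 by exact: powR_gt0.
have := hk _ w'0; have := powR_chord a01 w0 w'0; rewrite !rootK// => H1 H2.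
apply: le_trans H2; rewrite lerD2l -mulrA ler_wpM2l//.
by rewrite mulrC; lra.
Qed.

(* Powers [w^a] with [a < 1] are dominated by any linear function of [w], so [h] grows superlinearly. *)
Lemma convex_powR_superlinear (R : realType) (h : R -> R) (a n : R) :
  0 < a < 1 -> convex_pos (fun w => h (w `^ a)) ->
  (exists x y, [/\ 0 < x, x < y & h x < h y]) -> 0 < n ->
  exists c, forall x, 0 < x -> n * x - h x <= c.
Proof.
move=> /andP[a0 a1] hc [x [y [x0 xy hxy]]] n0.
have y0 : 0 < y by lra.
have rootK z : 0 < z -> (z `^ a^-1) `^ a = z.
  by move=> z0; rewrite -powRrM mulVf ?gt_eqF// powRr1// ltW.
have root0 z : 0 < z -> 0 < z `^ a^-1 by exact: powR_gt0.
have [k /= hk] := convex_pos_subgradient hc (root0 _ y0).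
have k0 : 0 < k.
  have := hk _ (root0 _ x0); rewrite !rootK//.
  have : x `^ a^-1 < y `^ a^-1.
    by apply: gt0_ltr_powR; rewrite ?invr_gt0// nnegrE ltW.
  by rewrite -subr_lt0 => d0; nra.
(* Chosen so that the slope w^(1-a)/a of the root, multiplied by [k], equals [n]. *)
pose w := (a * n / k) `^ (1 - a)^-1.
have ank : 0 < a * n / k by rewrite divr_gt0 ?mulr_gt0.
have w0 : 0 < w by exact: powR_gt0.
have a01 : 0 < a <= 1 by rewrite a0 ltW.
exists (n * w `^ a - h y - k * (w - y `^ a^-1)) => z z0.
have := hk _ (root0 _ z0); have := powR_chord a01 w0 (root0 _ z0).
have -> : w `^ (1 - a) = a * n / k.
  by rewrite -powRrM mulVf ?powRr1 ?ltW// gt_eqF// subr_gt0.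
rewrite !rootK// (_ : a * n / k / a = n / k); last by field; rewrite !gt_eqF.
move=> H1; have := ler_wpM2l (ltW k0) H1.
rewrite mulrDr (_ : k * ((z - w `^ a) * (n / k)) = n * (z - w `^ a)); last first.
  by field; rewrite gt_eqF.
by lra.
Qed.

(** The Legendre conjugate of h at the slope 1/v; [superlinear] says that it is finite at every
    positive slope. *)
Definition mdual (R : realType) (h : R -> R) (v : R) : R :=
  sup_pos (fun x => x / v - h x).

Definition superlinear (R : realType) (h : R -> R) : Prop :=
  forall n, 0 < n -> exists c, forall x, 0 < x -> n * x - h x <= c.

Lemma mdual_bound (R : realType) (h : R -> R) (v : R) :
  superlinear h -> 0 < v -> exists c, forall x, 0 < x -> x / v - h x <= c.
Proof.
move=> hs v0; have vV0 : 0 < v^-1 by rewrite invr_gt0.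
by have [c hc] := hs _ vV0; exists c => x x0; rewrite mulrC; exact: hc.
Qed.

Lemma mdual_ge (R : realType) (h : R -> R) (x v : R) :
  superlinear h -> 0 < x -> 0 < v -> x / v <= h x + mdual h v.
Proof.
move=> hs x0 v0; have [c hc] := mdual_bound hs v0.
by have := sup_pos_ge hc x0; rewrite -/(mdual h v); lra.
Qed.

(** A positive subgradient gives an exact optimum 1/v. If the subgradient is 0, then x minimizes h
    and a small positive slope is optimal up to [d]. *)
Lemma mdual_attained (R : realType) (h : R -> R) (x d : R) :
  superlinear h ->
  (exists2 k, 0 <= k & forall y, 0 < y -> h x + k * (y - x) <= h y) ->
  0 < x -> 0 < d -> exists2 v, 0 < v & h x + mdual h v <= x / v + d.
Proof.
move=> hs [k k0 hk] x0 d0.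
suff [n n0 hn] : exists2 n, 0 < n &
    forall y, 0 < y -> n * y - h y <= n * x - h x + d.
  exists n^-1; rewrite ?invr_gt0// invrK.
  have : mdual h n^-1 <= n * x - h x + d.
    by apply: sup_pos_le => y y0; rewrite invrK mulrC; exact: hn.
  by lra.
have [kp|kn] := ltP 0 k; first by exists k => // y y0; have := hk y y0; lra.
have {k kn k0}hk y : 0 < y -> h x <= h y.
  by move=> y0; have := hk y y0; rewrite (_ : k = 0) ?mul0r ?addr0//; lra.
(* Above [K] the bound h y >= y - c beats any slope at most 1/2; below [K] a slope at most d / K
   adds at most [d]. *)
have [c hc] := hs 1 ltr01; pose K := Num.max 1 (2 * (c + h x)).
have K0 : 0 < K by rewrite lt_max ltr01.
have dK : 0 < d / K by exact: divr_gt0.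
exists (Num.min 2^-1 (d / K)); first by rewrite lt_min dK andbT; lra.
move=> y y0; set n := Num.min _ _.
have n0 : 0 < n by rewrite lt_min dK andbT; lra.
have n2 : n <= 2^-1 by rewrite ge_min lexx.
have nK : n * K <= d by rewrite -ler_pdivlMr// ge_min lexx orbT.
have nx : 0 < n * x by exact: mulr_gt0.
have [yK|Ky] := leP y K; first by have := hk y y0; nra.
have : 2 * (c + h x) < y by apply: le_lt_trans Ky; rewrite le_max lexx orbT.
by have := hc y y0; nra.
Qed.

(** With x = w^(1+p), - m(u^p) is the infimum over w of h(w^(1+p)) - w^(1+p) u^(-p). This is jointly
    convex in (w, u) because the exponents 1 + p and - p sum to 1, and a partial infimum preserves
    convexity. *)
Lemma mdual_powR_convex (R : realType) (h : R -> R) (p : R) :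
  -1 < p < 0 -> superlinear h -> convex_pos (fun w => h (w `^ (1 + p))) ->
  convex_pos (fun u => - mdual h (u `^ p)).
Proof.
move=> /andP[p1 p0] hs hc u1 u2 t u10 u20 t01.
set u := t * u1 + _; have u0 : 0 < u by exact: conv_gt0.
have a0 : 1 + p != 0 by rewrite gt_eqF//; lra.
apply/ler_addgt0Pr => d d0.
have near v : 0 < v -> exists2 w, 0 < w &
    mdual h (v `^ p) < w `^ (1 + p) * v `^ (1 - (1 + p)) - h (w `^ (1 + p)) + d.
  move=> v0; have [c hb] := mdual_bound hs (powR_gt0 p v0).
  have [x x0 hx] := sup_pos_adherent hb d0.
  exists (x `^ (1 + p)^-1); first exact: powR_gt0.
  rewrite -powRrM mulVf// powRr1 ?(ltW x0)//.
  by rewrite (_ : 1 - (1 + p) = - p) ?powRN//; ring.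
have [w1 w10 H1] := near _ u10; have [w2 w20 H2] := near _ u20.
have := hc _ _ _ w10 w20 t01; rewrite /=.
have a01 : 0 <= 1 + p <= 1 by apply/andP; split; lra.
have := powR_prod_concave a01 t01 w10 w20 u10 u20.
set w := t * w1 + _; have w0 : 0 < w by exact: conv_gt0.
have := mdual_ge hs (powR_gt0 (1 + p) w0) (powR_gt0 p u0).
rewrite -powRN (_ : - p = 1 - (1 + p)); last by ring.
rewrite -/u; case/andP: t01 => t0 t1.
have t1' : 0 <= 1 - t by lra.
have := ler_wpM2l t0 (ltW H1); have := ler_wpM2l t1' (ltW H2).
by lra.
Qed.

(** The Legendre conjugate of m at the slope - y^(1-p); the exponent 1 - p complements p to degree
    one, as in the trace Tr K^* A^p K Y^(1-p). *)
Definition edual (R : realType) (m : R -> R) (p y : R) : R :=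
  sup_pos (fun x => - m x - x * y `^ (1 - p)).

(** Testing the supremum that defines m(x) at the point 1 gives m(x) >= 1/x - h(1). *)
Lemma edual_bound (R : realType) (h : R -> R) (p y : R) : superlinear h ->
  forall x, 0 < x -> - mdual h x - x * y `^ (1 - p) <= h 1.
Proof.
move=> hs x x0; have := mdual_ge hs ltr01 x0.
have : 0 < 1 / x by exact: divr_gt0.
have : 0 <= x * y `^ (1 - p) by rewrite mulr_ge0 ?powR_ge0// ltW.
by lra.
Qed.

Lemma edual_ge (R : realType) (h : R -> R) (p x y : R) :
  superlinear h -> 0 < x ->
  - mdual h x <= x * y `^ (1 - p) + edual (mdual h) p y.
Proof.
move=> hs x0; have := sup_pos_ge (@edual_bound R h p y hs) x0.
by rewrite -/(edual (mdual h) p y); lra.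
Qed.

(* [- mdual h] is an infimum of the concave functions [x |-> h z - z / x], whose tangent lines serve as its supporting lines. *)
Lemma edual_attained (R : realType) (h : R -> R) (p x d : R) :
  p < 1 -> superlinear h -> 0 < x -> 0 < d ->
  exists2 y, 0 < y &
    x * y `^ (1 - p) + edual (mdual h) p y <= - mdual h x + d.
Proof.
move=> p1 hs x0 d0; have [c hb] := mdual_bound hs x0.
have [z z0 hz] := sup_pos_adherent hb d0.
have zx : 0 < z / x ^+ 2 by rewrite divr_gt0 ?exprn_gt0.
(* This makes y^(1-p) equal to z / x^2, the derivative of h z - z / x with respect to x, for the
   near-optimal [z]. *)
exists ((z / x ^+ 2) `^ (1 - p)^-1); first exact: powR_gt0.
rewrite /edual -powRrM mulVf ?subr_eq0 ?gt_eqF// powRr1 ?(ltW zx)//.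
rewrite -lerBrDl; apply: sup_pos_le => y y0.
have := mdual_ge hs z0 y0; rewrite -/(mdual h x) in hz *.
have : z * (2 / x - y / x ^+ 2) <= z / y.
  rewrite ler_pM2l// -subr_ge0.
  have -> : y^-1 - (2 / x - y / x ^+ 2) = (y - x) ^+ 2 / (y * x ^+ 2).
    by field; rewrite !gt_eqF.
  by rewrite divr_ge0 ?sqr_ge0// mulr_ge0 ?sqr_ge0// ltW.
have -> : z * (2 / x - y / x ^+ 2) = 2 * (z / x) - y * (z / x ^+ 2) by ring.
have -> : x * (z / x ^+ 2) = z / x by field; rewrite gt_eqF.
by move: hz; rewrite -/(mdual h x); lra.
Qed.

(* The substitution x = (y v)^p makes x y^(1-p) = y v^p linear in y. *)
Lemma edual_convex (R : realType) (m : R -> R) (p c : R) :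
  p < 0 -> (forall x y, 0 < x -> - m x - x * y `^ (1 - p) <= c) ->
  convex_pos (fun u => - m (u `^ p)) -> convex_pos (edual m p).
Proof.
move=> p0 mb mc y1 y2 t y10 y20 t01.
set y := t * y1 + _; have y0 : 0 < y by exact: conv_gt0.
apply: sup_pos_le => x x0.
have [v v0 ->] : exists2 v, 0 < v & x = (y * v) `^ p.
  exists (x `^ p^-1 / y); first by rewrite divr_gt0 ?powR_gt0.
  by rewrite mulrC divfK ?gt_eqF// -powRrM mulVf ?lt_eqF// powRr1// ltW.
have lin z : 0 < z -> (z * v) `^ p * z `^ (1 - p) = z * v `^ p.
  move=> z0; rewrite powRM ?ltW// mulrAC -powRD ?(gt_eqF z0) ?implybT//.
  by rewrite (addrC p) subrK powRr1 ?ltW.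
rewrite lin//.
have up z : 0 < z -> - m ((z * v) `^ p) <= z * v `^ p + edual m p z.
  move=> z0; rewrite -lin//.
  have := @sup_pos_ge R _ c ((z * v) `^ p) (fun x => mb x z).
  rewrite -/(edual m p z) => /(_ (powR_gt0 _ (mulr_gt0 z0 v0))).
  by lra.
have := mc _ _ _ (mulr_gt0 y10 v0) (mulr_gt0 y20 v0) t01.
rewrite /= !mulrA -mulrDl -/y.
move: (up _ y10) (up _ y20); case/andP: t01 => t0 t1 H1 H2 H3.
have t1' : 0 <= 1 - t by lra.
have := ler_wpM2l t0 H1; have := ler_wpM2l t1' H2.
have -> : y * v `^ p = t * (y1 * v `^ p) + (1 - t) * (y2 * v `^ p).
  by rewrite /y; ring.
by lra.
Qed.

(** For p = -1 the function f itself is convex. If it increased somewhere, a line of positive slope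
    would lie below it, against f(x)/x -> 0. *)
Lemma constant_or_gtN1 (R : realType) (f : R -> R) (p : R) :
  -1 <= p ->
  (forall x y : R, 0 < x -> x <= y -> f x <= f y) ->
  ((fun x => f x / x) @ +oo --> (0 : R)) ->
  convex_pos (fun x => f (x `^ (2 + p))) ->
  (forall x y, 0 < x -> 0 < y -> f x = f y) \/
  -1 < p /\ (exists x y, [/\ 0 < x, x < y & f x < f y]).
Proof.
move=> p1 fm fl fg.
have [fc|] := pselect (forall x y, 0 < x -> 0 < y -> f x = f y); first by left.
move=> nfc; right.
have nc : exists x y, [/\ 0 < x, x < y & f x < f y].
  apply: contra_notP nfc => nc x y x0 y0.
  wlog xy : x y x0 y0 / x <= y.
    by move=> W; have [/W|/ltW /W W'] := leP x y; [exact|rewrite W'].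
  apply/eqP; rewrite eq_le fm//= leNgt; apply/negP => fxy; apply: nc.
  exists x, y; split => //; rewrite lt_neqAle xy andbT.
  by apply: contraTneq fxy => ->; rewrite ltxx.
split => //; rewrite lt_neqAle p1 andbT; apply/eqP => ep.
have {}fg : convex_pos f.
  move=> x y t x0 y0 t01; have := fg x y t x0 y0 t01.
  rewrite -ep (_ : 2 + -1 = 1); last by ring.
  by rewrite !powRr1 ?(ltW x0) ?(ltW y0)// ltW// conv_gt0.
have [x [y [x0 xy fxy]]] := nc; have y0 : 0 < y by lra.
have [k hk] := convex_pos_subgradient fg y0.
have k0 : 0 < k by have := hk x x0; nra.
have k20 : 0 < k / 2 by lra.
have /cvgrPdist_lt /(_ _ k20) [M [_ HM]] := fl.
(* Large enough that the supporting line at [y] is at least k S / 2 at S, whereas the limit forces f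
   S < k S / 2. *)
pose S := Num.max (M + 1) (Num.max 1 (2 * (k * y - f y) / k)).
have S0 : 0 < S by rewrite !lt_max ltr01 orbT.
have MS : M < S by rewrite lt_max; apply/orP; left; lra.
have := HM _ MS; rewrite /= sub0r normrN => /ltr_normlW.
rewrite ltr_pdivrMr// => fS; have := hk _ S0.
have : 2 * (k * y - f y) / k <= S by rewrite !le_max lexx !orbT.
by rewrite ler_pdivrMr//; lra.
Qed.

(** * Functional calculus *)

Local Open Scope sesquilinear_scope.

Lemma RtoCE (R : realType) (x : R) : RtoC x = (x%:C)%C.
Proof. by []. Qed.

Lemma RtoCM (R : realType) (x y : R) : RtoC (x * y) = RtoC x * RtoC y.
Proof. exact: (rmorphM (real_complex R)). Qed.

Lemma RtoC_conj (R : realType) (x : R) : (RtoC x)^* = RtoC x.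
Proof. by rewrite /RtoC; congr Complex; rewrite oppr0. Qed.

Lemma ReD (R : realType) (x y : R[i]) :
  complex.Re (x + y) = complex.Re x + complex.Re y.
Proof. by case: x; case: y. Qed.

Lemma Re_sum (R : realType) (I : finType) (F : I -> R[i]) :
  complex.Re (\sum_i F i) = \sum_i complex.Re (F i).
Proof. by elim/big_ind2: _ => // x x' y y' <- <-; rewrite ReD. Qed.

Lemma ReZ (R : realType) (t : R) (x : R[i]) :
  complex.Re (RtoC t * x) = t * complex.Re x.
Proof. by case: x => a b /=; rewrite mul0r subr0. Qed.

Lemma trmxC_mul (C : numClosedFieldType) m n l (A : 'M[C]_(m, n)) (B : 'M[C]_(n, l)) :
  (A *m B) ^t* = B ^t* *m A ^t*.
Proof. by rewrite trmx_mul map_mxM. Qed.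

Lemma qform_mul (C : numClosedFieldType) m n (A : 'M[C]_n) (v : 'rV[C]_m)
    (T : 'M[C]_(m, n)) :
  qform A (v *m T) = qform (T *m A *m T ^t*) v.
Proof. by rewrite /qform trmxC_mul !mulmxA. Qed.

Lemma qform_delta (C : numClosedFieldType) n (A : 'M[C]_n) i :
  qform A (delta_mx 0 i) = A i i.
Proof.
rewrite /qform -rowE trmx_delta map_delta_mx -colE !mxE //.
Qed.

Lemma normal_qform0 (C : numClosedFieldType) n (A : 'M[C]_n) :
  A \is normalmx -> (forall v, qform A v = 0) -> A = 0.
Proof.
move=> nA qA; have /orthomx_spectralP EA := nA.
have dA : spectral_diag A = 0.
  apply/rowP => i; rewrite [RHS]mxE.
  have := qA (delta_mx 0 i *m spectralmx A).
  rewrite qform_mul qform_delta {2}EA -invmx_unitary ?spectral_unitarymx//.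
  rewrite !mulmxA mulmxV ?spectral_unit// mul1mx mulmxK ?spectral_unit//.
  by rewrite !mxE eqxx.
by rewrite EA dA raddf0 mulmx0 mul0mx.
Qed.

Lemma qform_conj (C : numClosedFieldType) n (A : 'M[C]_n) v :
  qform (A ^t*) v = (qform A v)^*.
Proof.
have -> : (qform A v)^* = ((v *m A *m v ^t*) ^t*) 0 0.
  by rewrite [RHS]mxE [X in _ = Num.conj X]mxE.
by rewrite /qform !trmxC_mul trmxCK mulmxA.
Qed.

Lemma qformD (C : numClosedFieldType) n (A B : 'M[C]_n) v :
  qform (A + B) v = qform A v + qform B v.
Proof. by rewrite /qform mulmxDr mulmxDl mxE. Qed.

Lemma qformZ (C : numClosedFieldType) n (a : C) (A : 'M[C]_n) v :
  qform (a *: A) v = a * qform A v.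
Proof. by rewrite /qform -scalemxAr -scalemxAl mxE. Qed.

(** The difference A^* - A is skew-Hermitian, hence normal, and its form vanishes because that of A
    is real; a normal matrix with zero form has only zero eigenvalues. *)
Lemma psdmx_hermitian (C : numClosedFieldType) n (A : 'M[C]_n) :
  psdmx A -> A ^t* = A.
Proof.
move=> pA; apply/eqP; rewrite -subr_eq0; apply/eqP; apply: normal_qform0.
  have E : (A ^t* - A) ^t* = - (A ^t* - A).
    by rewrite linearB /= map_mxB trmxCK opprB.
  by apply/normalmxP; rewrite E mulmxN mulNmx.
move=> v; rewrite qformD qform_conj (CrealP _) ?ger0_real//.
by rewrite -scaleN1r qformZ mulN1r subrr.
Qed.

Lemma psdmx_spectral (C : numClosedFieldType) n (A : 'M[C]_n) : psdmx A ->
  A = (spectralmx A) ^t* *m diag_mx (spectral_diag A) *m spectralmx A.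
Proof.
move=> pA; rewrite -invmx_unitary ?spectral_unitarymx//.
apply/orthomx_spectralP/hermitian_normalmx; rewrite is_hermitianmxE expr0 scale1r.
by rewrite psdmx_hermitian.
Qed.

Lemma spectralmxK (C : numClosedFieldType) n (A : 'M[C]_n) :
  spectralmx A *m (spectralmx A) ^t* = 1%:M.
Proof. by apply/unitarymxP/spectral_unitarymx. Qed.

Lemma spectralmxKV (C : numClosedFieldType) n (A : 'M[C]_n) :
  (spectralmx A) ^t* *m spectralmx A = 1%:M.
Proof. by rewrite -invmx_unitary ?spectral_unitarymx// mulVmx// spectral_unit. Qed.

Lemma spectral_diag_qform (C : numClosedFieldType) n (A : 'M[C]_n) i : psdmx A ->
  spectral_diag A 0 i = qform A (delta_mx 0 i *m spectralmx A).
Proof.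
move=> pA; rewrite qform_mul qform_delta {3}(psdmx_spectral pA).
rewrite !mulmxA spectralmxK mul1mx -mulmxA spectralmxK mulmx1.
by rewrite [RHS]mxE eqxx.
Qed.

Lemma posdefmxW (C : numClosedFieldType) n (A : 'M[C]_n) : posdefmx A -> psdmx A.
Proof.
move=> pA v; have [->|v0] := eqVneq v 0; last exact: ltW (pA v v0).
by rewrite /qform !mul0mx mxE.
Qed.

Definition ev (R : realType) n (A : 'M[R[i]]_n) (i : 'I_n) : R :=
  complex.Re (spectral_diag A 0 i).

Definition rdiag (R : realType) n (d : 'I_n -> R) : 'M[R[i]]_n :=
  diag_mx (\row_i RtoC (d i)).

Lemma rdiagM (R : realType) n (d d' : 'I_n -> R) :
  rdiag d *m rdiag d' = rdiag (fun i => d i * d' i).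
Proof.
rewrite /rdiag mulmx_diag; congr diag_mx; apply/rowP => i.
by rewrite !mxE RtoCM.
Qed.

Lemma rdiag_conj (R : realType) n (d : 'I_n -> R) : (rdiag d) ^t* = rdiag d.
Proof.
apply/matrixP => i j; rewrite !mxE [in LHS]eq_sym.
by have [->|] := eqVneq; rewrite ?mulr1n ?mulr0n ?conjC0 ?RtoC_conj.
Qed.

Lemma mxfunE (R : realType) n (g : R -> R) (A : 'M[R[i]]_n) :
  mxfun g A = (spectralmx A) ^t* *m rdiag (fun i => g (ev A i)) *m spectralmx A.
Proof.
have E : map_mx (fun z : R[i] => RtoC (g (complex.Re z))) (spectral_diag A) =
    \row_i RtoC (g (ev A i)) by apply/rowP => i; rewrite !mxE.
by rewrite /mxfun E (invmx_unitary (spectral_unitarymx A)).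
Qed.

Lemma mxfun_id (R : realType) n (A : 'M[R[i]]_n) : posdefmx A -> mxfun id A = A.
Proof.
move=> /posdefmxW pA; have E : rdiag (ev A) = diag_mx (spectral_diag A).
  congr diag_mx; apply/rowP => i; rewrite mxE RtoCE /ev RRe_real// ger0_real//.
  by rewrite spectral_diag_qform.
by rewrite mxfunE E; exact: esym (psdmx_spectral pA).
Qed.

Lemma ev_gt0 (R : realType) n (A : 'M[R[i]]_n) i : posdefmx A -> 0 < ev A i.
Proof.
move=> pA; have : 0 < spectral_diag A 0 i.
  rewrite spectral_diag_qform; last exact: posdefmxW.
  apply: pA; apply/eqP => /(congr1 (mulmx^~ ((spectralmx A) ^t*))).
  rewrite -mulmxA spectralmxK mulmx1 mul0mx => /rowP/(_ i).
  by rewrite !mxE !eqxx => /eqP; rewrite oner_eq0.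
by rewrite ltcE => /andP[].
Qed.

Lemma eq_mxfun (R : realType) n (g k : R -> R) (A : 'M[R[i]]_n) :
  posdefmx A -> (forall x, 0 < x -> g x = k x) -> mxfun g A = mxfun k A.
Proof.
move=> pA gk; have E : (fun i => g (ev A i)) = (fun i => k (ev A i)).
  by apply/funext => i; rewrite gk ?(ev_gt0 i pA).
by rewrite (mxfunE g) (mxfunE k) E.
Qed.

Lemma mxfunM (R : realType) n (g k : R -> R) (A : 'M[R[i]]_n) :
  mxfun g A *m mxfun k A = mxfun (fun x => g x * k x) A.
Proof.
rewrite !mxfunE !mulmxA -(mulmxA _ (spectralmx A)) spectralmxK mulmx1.
by rewrite -(mulmxA _ (rdiag _) (rdiag _)) rdiagM.
Qed.

Lemma mxfun_cst1 (R : realType) n (A : 'M[R[i]]_n) : mxfun (fun=> 1) A = 1%:M.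
Proof.
rewrite mxfunE (_ : rdiag _ = 1%:M) ?mulmx1 ?spectralmxKV//.
by apply/matrixP => i j; rewrite !mxE.
Qed.

Lemma mxfun_hermitian (R : realType) n (g : R -> R) (A : 'M[R[i]]_n) :
  (mxfun g A) ^t* = mxfun g A.
Proof. by rewrite mxfunE !trmxC_mul trmxCK rdiag_conj mulmxA. Qed.

Lemma posdefmx_unit (C : numClosedFieldType) n (A : 'M[C]_n) :
  posdefmx A -> A \in unitmx.
Proof.
move=> pA; rewrite -row_free_unit -kermx_eq0; apply/eqP/row_matrixP => i.
rewrite row0; apply/eqP; apply: contraT => v0; have := pA _ v0.
have /sub_kermxP E : (row i (kermx A) <= kermx A)%MS by exact: row_sub.
by rewrite /qform E mul0mx mxE ltxx.
Qed.

Lemma posdefmx_congr (C : numClosedFieldType) n (A T : 'M[C]_n) :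
  T \in unitmx -> posdefmx A -> posdefmx (T *m A *m T ^t*).
Proof.
move=> uT pA v v0; rewrite -qform_mul; apply: pA; apply: contra_neq v0 => E.
by rewrite -(mulmxK uT v) E mul0mx.
Qed.

Lemma posdefmx_mxfun (R : realType) n (g : R -> R) (A : 'M[R[i]]_n) :
  posdefmx A -> (forall x, 0 < x -> 0 < g x) -> posdefmx (mxfun g A).
Proof.
move=> pA g0; rewrite mxfunE -{2}[spectralmx A]trmxCK; apply: posdefmx_congr.
  by rewrite -invmx_unitary ?spectral_unitarymx// unitmx_inv spectral_unit.
move=> v v0; have E : qform (rdiag (fun i => g (ev A i))) v =
    \sum_j RtoC (g (ev A j)) * (v 0 j * (v 0 j)^*).
  rewrite /qform mxE; apply: eq_bigr => j _.
  by rewrite mul_mx_diag !mxE mulrA (mulrC (v 0 j)).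
have pg j : 0 < RtoC (g (ev A j)) by rewrite RtoCE ltcR g0// ev_gt0.
have nn j : 0 <= RtoC (g (ev A j)) * (v 0 j * (v 0 j)^*).
  by rewrite mulr_ge0 ?mul_conjC_ge0// ltW.
rewrite E lt_neqAle sumr_ge0 ?andbT; last by move=> j _.
rewrite eq_sym; apply: contra_neq v0 => /eqP.
rewrite psumr_eq0; last by move=> j _.
move=> /allP H; apply/rowP => j; rewrite mxE; apply/eqP.
have := H j (mem_index_enum j); rewrite /= mulf_eq0 mul_conjC_eq0.
by rewrite gt_eqF//.
Qed.

Lemma mxfun_inv (R : realType) n (A : 'M[R[i]]_n) :
  posdefmx A -> mxfun GRing.inv A = invmx A.
Proof.
move=> pA; have uA := posdefmx_unit pA; apply: (can_inj (mulKmx uA)).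
rewrite mulmxV// -{1}(mxfun_id pA) mxfunM -[RHS](mxfun_cst1 A).
by apply: eq_mxfun => // x x0; rewrite divff// gt_eqF.
Qed.

Lemma posdefmx_inv (R : realType) n (A : 'M[R[i]]_n) :
  posdefmx A -> posdefmx (invmx A).
Proof.
move=> pA; rewrite -(mxfun_inv pA); apply: (posdefmx_mxfun pA) => x x0.
by rewrite invr_gt0.
Qed.

Lemma posdefmx_conv (R : realType) n (A B : 'M[R[i]]_n) (t : R) :
  posdefmx A -> posdefmx B -> 0 <= t <= 1 ->
  posdefmx (RtoC t *: A + RtoC (1 - t) *: B).
Proof.
move=> pA pB /andP[t0 t1] v v0; rewrite qformD !qformZ.
have [->|tn0] := eqVneq t 0.
  by rewrite subr0 RtoCE rmorph0 mul0r add0r RtoCE rmorph1 mul1r; exact: pB.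
have tp : 0 < t by rewrite lt_neqAle eq_sym tn0.
apply: ltr_wpDr; last by rewrite mulr_gt0 ?pA// RtoCE ltcR.
by rewrite mulr_ge0 ?RtoCE ?lecR ?subr_ge0// ltW// pB.
Qed.

(** Makes the calculus independent of the chosen spectral decomposition. In the eigenbasis of A, a
    nonzero entry (i, j) of the intertwiner forces [ev A i = d j], and hence equality after applying
    g. *)
Lemma mxfun_diagonalizes (R : realType) n m (g : R -> R) (A : 'M[R[i]]_n)
    (T : 'M[R[i]]_(n, m)) (d : 'I_m -> R) : posdefmx A ->
  A *m T = T *m rdiag d -> mxfun g A *m T = T *m rdiag (fun i => g (d i)).
Proof.
move=> pA; rewrite -{1}(mxfun_id pA) !mxfunE => E.
have core (W : 'M[R[i]]_(n, m)) : rdiag (ev A) *m W = W *m rdiag d ->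
    rdiag (fun i => g (ev A i)) *m W = W *m rdiag (fun i => g (d i)).
  move=> EW; apply/matrixP => i j; move/matrixP/(_ i j): EW.
  rewrite /rdiag !mul_diag_mx !mul_mx_diag !mxE.
  have [->|W0] := eqVneq (W i j) 0; first by rewrite !mulr0 !mul0r.
  by rewrite [RHS]mulrC => /(mulIf W0) [->]; rewrite mulrC.
rewrite -!mulmxA core; first by rewrite !mulmxA spectralmxKV mul1mx.
by rewrite -[RHS]mulmxA -E !mulmxA spectralmxK mul1mx.
Qed.

Lemma mxfun_intertwine (R : realType) n m (g : R -> R) (A : 'M[R[i]]_n)
    (B : 'M[R[i]]_m) (T : 'M[R[i]]_(n, m)) : posdefmx A -> posdefmx B ->
  A *m T = T *m B -> mxfun g A *m T = T *m mxfun g B.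
Proof.
move=> pA pB E.
have : A *m (T *m (spectralmx B) ^t*) = T *m (spectralmx B) ^t* *m rdiag (ev B).
  rewrite mulmxA E -{1}(mxfun_id pB) mxfunE !mulmxA -[LHS]mulmxA.
  by rewrite spectralmxK mulmx1.
move=> /(mxfun_diagonalizes g pA) /(congr1 (mulmx^~ (spectralmx B))).
by rewrite (mxfunE g B) !mulmxA -[X in X = _]mulmxA spectralmxKV mulmx1.
Qed.

Lemma mxfun_comp (R : realType) n (g k : R -> R) (A : 'M[R[i]]_n) :
  posdefmx A -> (forall x, 0 < x -> 0 < k x) ->
  mxfun g (mxfun k A) = mxfun (fun x => g (k x)) A.
Proof.
move=> pA k0; have pk := posdefmx_mxfun pA k0.
(* The matrix [mxfun k A] has its own chosen eigenbasis; that of A diagonalizes it too. *)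
have : mxfun k A *m (spectralmx A) ^t* =
       (spectralmx A) ^t* *m rdiag (fun i => k (ev A i)).
  by rewrite mxfunE -[LHS]mulmxA spectralmxK mulmx1.
move=> /(mxfun_diagonalizes g pk) /(congr1 (mulmx^~ (spectralmx A))).
by rewrite -[LHS]mulmxA spectralmxKV mulmx1 (mxfunE (fun x => g (k x))) => ->.
Qed.

(** * Trace inequalities *)

Definition Rtr (R : realType) n (A : 'M[R[i]]_n) : R := complex.Re (\tr A).

Lemma RtrD (R : realType) n (A B : 'M[R[i]]_n) : Rtr (A + B) = Rtr A + Rtr B.
Proof. by rewrite /Rtr mxtraceD ReD. Qed.

Lemma RtrZ (R : realType) n (t : R) (A : 'M[R[i]]_n) : Rtr (RtoC t *: A) = t * Rtr A.
Proof. by rewrite /Rtr mxtraceZ ReZ. Qed.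

Lemma RtrN (R : realType) n (A : 'M[R[i]]_n) : Rtr (- A) = - Rtr A.
Proof.
by apply/eqP; rewrite -addr_eq0 -RtrD addNr /Rtr mxtrace0.
Qed.

Lemma mxfunN (R : realType) n (g : R -> R) (A : 'M[R[i]]_n) :
  mxfun (fun x => - g x) A = - mxfun g A.
Proof.
have E : rdiag (fun i => - g (ev A i)) = - rdiag (fun i => g (ev A i)).
  by apply/matrixP => i j; rewrite !mxE RtoCE rmorphN mulNrn.
by rewrite (mxfunE g) (mxfunE (fun x => - g x)) E mulmxN mulNmx.
Qed.

Lemma Rtr_mulC (R : realType) m n (A : 'M[R[i]]_(m, n)) (B : 'M[R[i]]_(n, m)) :
  Rtr (A *m B) = Rtr (B *m A).
Proof. by rewrite /Rtr mxtrace_mulC. Qed.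

Lemma Rtr_sum (R : realType) n (I : finType) (F : I -> 'M[R[i]]_n) :
  Rtr (\sum_i F i) = \sum_i Rtr (F i).
Proof. by elim/big_ind2: _ => [|A x B y <- <-|//]; rewrite ?RtrD// /Rtr mxtrace0. Qed.

Lemma Rtr_rdiag (R : realType) n (d : 'I_n -> R) : Rtr (rdiag d) = \sum_i d i.
Proof.
by rewrite /Rtr mxtrace_diag Re_sum; apply: eq_bigr => i _; rewrite mxE.
Qed.

Lemma Rtr_mxfun (R : realType) n (g : R -> R) (A : 'M[R[i]]_n) :
  Rtr (mxfun g A) = \sum_i g (ev A i).
Proof. by rewrite mxfunE Rtr_mulC mulmxA spectralmxK mul1mx Rtr_rdiag. Qed.

Lemma Rtr_mul_mxfun (R : realType) n (g : R -> R) (A : 'M[R[i]]_n) :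
  posdefmx A -> Rtr (A *m mxfun g A) = \sum_i ev A i * g (ev A i).
Proof.
move=> pA; transitivity (Rtr (mxfun id A *m mxfun g A)).
  exact: (congr1 (fun B => Rtr (B *m mxfun g A)) (esym (mxfun_id pA))).
exact: (etrans (congr1 (@Rtr R n) (mxfunM id g A)) (Rtr_mxfun _ A)).
Qed.

(** The matrix of X in the eigenbases of A and Y. On its (i, j) entry L_A and R_Y act as
    multiplication by [ev A i] and [ev Y j]. *)
Definition coords (R : realType) n l (A : 'M[R[i]]_n) (Y : 'M[R[i]]_l)
  (X : 'M[R[i]]_(n, l)) : 'M[R[i]]_(n, l) :=
  spectralmx A *m X *m (spectralmx Y) ^t*.

Definition redot (R : realType) (z w : R[i]) : R :=
  complex.Re z * complex.Re w + complex.Im z * complex.Im w.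

Lemma redotE (R : realType) (z w : R[i]) : redot z w = complex.Re (z^* * w).
Proof. by case: z; case: w => a b c d; rewrite /redot /= mulNr opprK. Qed.

Lemma redot_ge0 (R : realType) (z : R[i]) : 0 <= redot z z.
Proof. by rewrite /redot -!expr2 addr_ge0 ?sqr_ge0. Qed.

(* [u(L_A, R_Y)], the joint functional calculus of the commuting operators of
   left multiplication by A and right multiplication by Y, as a sesquilinear form. *)
Definition Qf (R : realType) n l (u : R -> R -> R) (A : 'M[R[i]]_n)
  (Y : 'M[R[i]]_l) (W X : 'M[R[i]]_(n, l)) : R :=
  \sum_i \sum_j redot (coords A Y W i j) (coords A Y X i j) * u (ev A i) (ev Y j).

Lemma coordsD (R : realType) n l (A : 'M[R[i]]_n) (Y : 'M[R[i]]_l) X X' :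
  coords A Y (X + X') = coords A Y X + coords A Y X'.
Proof. by rewrite /coords mulmxDr mulmxDl. Qed.

(** The matrix obtained is c(L_A, R_Y) X; it provides the exact optimizers in the variational
    formulas for these forms. *)
Lemma exists_scaled_coords (R : realType) n l (A : 'M[R[i]]_n) (Y : 'M[R[i]]_l)
    (X : 'M[R[i]]_(n, l)) (c : R -> R -> R) :
  exists X', forall i j, coords A Y X' i j = RtoC (c (ev A i) (ev Y j)) * coords A Y X i j.
Proof.
exists ((spectralmx A) ^t* *m
  (\matrix_(i, j) (RtoC (c (ev A i) (ev Y j)) * coords A Y X i j)) *m spectralmx Y).
move=> i j; rewrite {1}/coords !mulmxA spectralmxK mul1mx -mulmxA spectralmxK.
by rewrite mulmx1 mxE.
Qed.

Lemma Qf_trace (R : realType) n l (g k : R -> R) (A : 'M[R[i]]_n)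
    (Y : 'M[R[i]]_l) (W X : 'M[R[i]]_(n, l)) :
  Qf (fun a y => g a * k y) A Y W X = Rtr (W ^t* *m mxfun g A *m X *m mxfun k Y).
Proof.
pose D := rdiag (fun i => g (ev A i)); pose E := rdiag (fun j => k (ev Y j)).
have -> : Rtr (W ^t* *m mxfun g A *m X *m mxfun k Y) =
          Rtr ((coords A Y W) ^t* *m (D *m coords A Y X *m E)).
  by rewrite !mxfunE /coords !trmxC_mul trmxCK !mulmxA Rtr_mulC !mulmxA.
rewrite /Qf; move: (coords A Y W) (coords A Y X) => P Q.
rewrite /Rtr /mxtrace Re_sum exchange_big; apply: eq_bigr => j _.
rewrite mxE Re_sum; apply: eq_bigr => i _.
rewrite mul_mx_diag mul_diag_mx !mxE redotE.
rewrite (_ : (P i j)^* * (_ * _ * _) =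
             RtoC (g (ev A i) * k (ev Y j)) * ((P i j)^* * Q i j)).
  by rewrite ReZ mulrC.
by rewrite RtoCM; ring.
Qed.

Lemma eq_Qf (R : realType) n l (u v : R -> R -> R) (A : 'M[R[i]]_n)
    (Y : 'M[R[i]]_l) W X : posdefmx A -> posdefmx Y ->
  (forall a y, 0 < a -> 0 < y -> u a y = v a y) -> Qf u A Y W X = Qf v A Y W X.
Proof.
move=> pA pY uv; apply: eq_bigr => i _; apply: eq_bigr => j _.
by rewrite uv// ev_gt0.
Qed.

Lemma le_Qf (R : realType) n l (u v : R -> R -> R) (A : 'M[R[i]]_n)
    (Y : 'M[R[i]]_l) X : posdefmx A -> posdefmx Y ->
  (forall a y, 0 < a -> 0 < y -> u a y <= v a y) -> Qf u A Y X X <= Qf v A Y X X.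
Proof.
move=> pA pY uv; apply: ler_sum => i _; apply: ler_sum => j _.
by apply: ler_wpM2l; [exact: redot_ge0|apply: uv; exact: ev_gt0].
Qed.

Lemma QfD (R : realType) n l (u v : R -> R -> R) (A : 'M[R[i]]_n)
    (Y : 'M[R[i]]_l) W X :
  Qf (fun a y => u a y + v a y) A Y W X = Qf u A Y W X + Qf v A Y W X.
Proof.
rewrite /Qf -big_split; apply: eq_bigr => i _; rewrite -big_split.
by apply: eq_bigr => j _; rewrite mulrDr.
Qed.

Lemma QfZ (R : realType) n l (c : R) (u : R -> R -> R) (A : 'M[R[i]]_n)
    (Y : 'M[R[i]]_l) W X :
  Qf (fun a y => c * u a y) A Y W X = c * Qf u A Y W X.
Proof.
rewrite /Qf mulr_sumr; apply: eq_bigr => i _; rewrite mulr_sumr.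
by apply: eq_bigr => j _; ring.
Qed.

(** Each trace is the form of a scalar function of the commuting operators L_X and R_Y at the
    identity matrix, so the scalar inequality is enough even if X and Y do not commute. *)
Lemma Rtr_Young (R : realType) n (a th b : R -> R) (X Y : 'M[R[i]]_n) :
  posdefmx X -> posdefmx Y ->
  (forall x y, 0 < x -> 0 < y -> a x <= x * th y + b y) ->
  Rtr (mxfun a X) <= Rtr (X *m mxfun th Y) + Rtr (mxfun b Y).
Proof.
move=> pX pY H.
have tr1 g k : Rtr (mxfun g X *m mxfun k Y) = Qf (fun x y => g x * k y) X Y 1%:M 1%:M.
  by rewrite Qf_trace trmx1 map_mx1 mul1mx mulmx1.
have -> : Rtr (mxfun a X) = Qf (fun x y => a x * 1) X Y 1%:M 1%:M.
  by rewrite -tr1 mxfun_cst1 mulmx1.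
have -> : Rtr (mxfun b Y) = Qf (fun x y => 1 * b y) X Y 1%:M 1%:M.
  by rewrite -tr1 mxfun_cst1 mul1mx.
rewrite (_ : X *m _ = mxfun id X *m mxfun th Y); last by rewrite mxfun_id.
rewrite tr1 -QfD; apply: le_Qf => // x y x0 y0.
by rewrite mulr1 mul1r; exact: H.
Qed.

(** Take Y = g(X) with g a pointwise near-optimizer: everything then commutes and the errors add up
    over the eigenvalues. *)
Lemma Rtr_Young_attained (R : realType) n (a th b : R -> R) (X : 'M[R[i]]_n) (e : R) :
  posdefmx X -> 0 < e ->
  (forall x d, 0 < x -> 0 < d -> exists2 y, 0 < y & x * th y + b y <= a x + d) ->
  exists2 Y, posdefmx Y &
    Rtr (X *m mxfun th Y) + Rtr (mxfun b Y) <= Rtr (mxfun a X) + e.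
Proof.
(* Dividing by [n.+1] keeps the denominator nonzero when n = 0. *)
move=> pX e0 H; pose d := e / n.+1%:R.
have d0 : 0 < d by rewrite divr_gt0// ltr0n.
have /choice[g hg] : forall x, exists y, 0 < x -> 0 < y /\ x * th y + b y <= a x + d.
  move=> x; have [x0|_] := ltP 0 x; last by exists 0.
  by have [y y0 hy] := H x d x0 d0; exists y.
have g0 x : 0 < x -> 0 < g x by move=> /hg[].
have [Y pY EY] : exists2 Y, posdefmx Y &
    forall k, mxfun k Y = mxfun (fun x => k (g x)) X.
  exists (mxfun g X); first exact: (posdefmx_mxfun pX g0).
  by move=> k; exact: (mxfun_comp k pX g0).
exists Y; first exact: pY.
have E1 := Rtr_mul_mxfun (fun x => th (g x)) pX; rewrite -(EY th) in E1.
have E2 := Rtr_mxfun (fun x => b (g x)) X; rewrite -(EY b) in E2.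
rewrite E1 E2 (Rtr_mxfun a X) -big_split /=; apply: (@le_trans _ _ (\sum_i (a (ev X i) + d))).
  by apply: ler_sum => i _; case: (hg _ (ev_gt0 i pX)).
rewrite big_split /= lerD2l sumr_const card_ord -mulr_natl /d mulrCA ger_pMr//.
by rewrite ler_pdivrMr ?ltr0n// mul1r ler_nat.
Qed.

Lemma affine_minorant_convex (R : realType) (t q q1 q2 c e e1 e2 : R) :
  0 <= t <= 1 -> e = q + c -> q = t * q1 + (1 - t) * q2 ->
  q1 + c <= e1 -> q2 + c <= e2 -> e <= t * e1 + (1 - t) * e2.
Proof.
case/andP=> t0 t1 -> -> H1 H2; have t1' : 0 <= 1 - t by lra.
by have := ler_wpM2l t0 H1; have := ler_wpM2l t1' H2; lra.
Qed.

(** The tangent lines of e, with slope k(x) and intercept b(x), lift to an affine minorant Tr Z k(Y)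
    + Tr b(Y) of Tr e(Z) that is exact at Z = Y. *)
Lemma Rtr_convex (R : realType) n (e : R -> R) (Y1 Y2 : 'M[R[i]]_n) (t : R) :
  posdefmx Y1 -> posdefmx Y2 -> 0 <= t <= 1 ->
  (forall x, 0 < x -> exists k, forall y, 0 < y -> e x + k * (y - x) <= e y) ->
  Rtr (mxfun e (RtoC t *: Y1 + RtoC (1 - t) *: Y2)) <=
  t * Rtr (mxfun e Y1) + (1 - t) * Rtr (mxfun e Y2).
Proof.
move=> p1 p2 t01 H; have pY := posdefmx_conv p1 p2 t01.
set Y := RtoC t *: Y1 + _ in pY *.
have /choice[k hk] : forall x, exists k, 0 < x ->
    forall y, 0 < y -> e x + k * (y - x) <= e y.
  move=> x; have [x0|_] := ltP 0 x; last by exists 0.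
  by have [k hk] := H x x0; exists k.
pose b x := e x - x * k x.
have bN x y : 0 < x -> 0 < y -> - e x <= x * - k y + - b y.
  by move=> x0 y0; have := hk y y0 x x0; rewrite /b; clear; lra.
have young Z : posdefmx Z ->
    Rtr (Z *m mxfun k Y) + Rtr (mxfun b Y) <= Rtr (mxfun e Z).
  move=> pZ; have neg (u v w u' v' w' : R) :
      u = - u' -> v = - v' -> w = - w' -> u <= v + w -> v' + w' <= u'.
    by move=> -> -> ->; lra.
  have trN g (B : 'M[R[i]]_n) : Rtr (mxfun (fun x => - g x) B) = - Rtr (mxfun g B).
    by rewrite mxfunN RtrN.
  have trMN : Rtr (Z *m mxfun (fun x => - k x) Y) = - Rtr (Z *m mxfun k Y).
    by rewrite mxfunN mulmxN RtrN.
  apply: (neg _ _ _ _ _ _ (trN e Z) trMN (trN b Y)).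
  exact: (Rtr_Young pZ pY bN).
have EY : Rtr (mxfun e Y) = Rtr (Y *m mxfun k Y) + Rtr (mxfun b Y).
  transitivity (\sum_i e (ev Y i)); first exact: Rtr_mxfun.
  rewrite (Rtr_mul_mxfun k pY) (Rtr_mxfun b Y) -big_split /=.
  by apply: eq_bigr => i _; rewrite /b addrC subrK.
have lin : Rtr (Y *m mxfun k Y) =
    t * Rtr (Y1 *m mxfun k Y) + (1 - t) * Rtr (Y2 *m mxfun k Y).
  by move: (mxfun k Y) => B; rewrite /Y mulmxDl -!scalemxAl RtrD !RtrZ.
exact: (affine_minorant_convex t01 EY lin (young _ p1) (young _ p2)).
Qed.

(** * Lieb and Ando convexity *)

Lemma eq_convex (R : realType) (t a a' b b' c c' : R) :
  a = a' -> b = b' -> c = c' ->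
  a' <= t * b' + (1 - t) * c' -> a <= t * b + (1 - t) * c.
Proof. by move=> -> -> ->. Qed.

Lemma eq_concave (R : realType) (t a a' b b' c c' : R) :
  a = a' -> b = b' -> c = c' ->
  t * b' + (1 - t) * c' <= a' -> t * b + (1 - t) * c <= a.
Proof. by move=> -> -> ->. Qed.

(** Operator concavity of u(L_A, R_Y) in the pair (A, Y), for matrices of all sizes. *)
Definition jconcave (R : realType) (u : R -> R -> R) : Prop :=
  forall n l (A1 A2 : 'M[R[i]]_n) (Y1 Y2 : 'M[R[i]]_l) X t,
    posdefmx A1 -> posdefmx A2 -> posdefmx Y1 -> posdefmx Y2 -> 0 <= t <= 1 ->
    t * Qf u A1 Y1 X X + (1 - t) * Qf u A2 Y2 X X <=
    Qf u (RtoC t *: A1 + RtoC (1 - t) *: A2) (RtoC t *: Y1 + RtoC (1 - t) *: Y2) X X.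

Lemma jconcave_ext (R : realType) (u v : R -> R -> R) :
  (forall a y, 0 < a -> 0 < y -> u a y = v a y) -> jconcave u -> jconcave v.
Proof.
move=> uv cu n l A1 A2 Y1 Y2 X t a1 a2 y1 y2 t01.
have E A Y (pA : posdefmx A) (pY : posdefmx Y) := esym (eq_Qf X X pA pY uv).
apply: (eq_concave (E _ _ (posdefmx_conv a1 a2 t01) (posdefmx_conv y1 y2 t01))
  (E _ _ a1 y1) (E _ _ a2 y2)).
exact: (cu _ _ _ _ _ _ X _ a1 a2 y1 y2 t01).
Qed.

Lemma Qf_fst (R : realType) n l (A : 'M[R[i]]_n) (Y : 'M[R[i]]_l) W X :
  posdefmx A -> posdefmx Y -> Qf (fun a y => a) A Y W X = Rtr (W ^t* *m A *m X).
Proof.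
move=> pA pY; rewrite (@eq_Qf _ _ _ _ (fun a y => id a * (fun=> 1) y))//; last first.
  by move=> a y _ _; rewrite mulr1.
by rewrite Qf_trace mxfun_cst1 mulmx1 mxfun_id.
Qed.

Lemma Qf_snd (R : realType) n l (A : 'M[R[i]]_n) (Y : 'M[R[i]]_l) W X :
  posdefmx A -> posdefmx Y -> Qf (fun a y => y) A Y W X = Rtr (W ^t* *m X *m Y).
Proof.
move=> pA pY; rewrite (@eq_Qf _ _ _ _ (fun a y => (fun=> 1) a * id y))//; last first.
  by move=> a y _ _; rewrite mul1r.
by rewrite Qf_trace mxfun_cst1 mulmx1 mxfun_id.
Qed.

Lemma jconcave_fst (R : realType) : @jconcave R (fun a y => a).
Proof.
move=> n l A1 A2 Y1 Y2 X t a1 a2 y1 y2 t01.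
apply: (eq_concave (Qf_fst X X (posdefmx_conv a1 a2 t01) (posdefmx_conv y1 y2 t01))
  (Qf_fst X X a1 y1) (Qf_fst X X a2 y2)).
by rewrite mulmxDr mulmxDl -!scalemxAr -!scalemxAl RtrD !RtrZ.
Qed.

Lemma jconcave_snd (R : realType) : @jconcave R (fun a y => y).
Proof.
move=> n l A1 A2 Y1 Y2 X t a1 a2 y1 y2 t01.
apply: (eq_concave (Qf_snd X X (posdefmx_conv a1 a2 t01) (posdefmx_conv y1 y2 t01))
  (Qf_snd X X a1 y1) (Qf_snd X X a2 y2)).
by rewrite mulmxDr -!scalemxAr RtrD !RtrZ.
Qed.

Lemma jconcaveD (R : realType) (u v : R -> R -> R) :
  jconcave u -> jconcave v -> jconcave (fun a y => u a y + v a y).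
Proof.
move=> cu cv n l A1 A2 Y1 Y2 X t a1 a2 y1 y2 t01; rewrite !QfD.
have := cu _ _ _ _ _ _ X _ a1 a2 y1 y2 t01; have := cv _ _ _ _ _ _ X _ a1 a2 y1 y2 t01.
by lra.
Qed.

Lemma jconcaveZ (R : realType) (c : R) (u : R -> R -> R) :
  0 <= c -> jconcave u -> jconcave (fun a y => c * u a y).
Proof.
move=> c0 cu n l A1 A2 Y1 Y2 X t a1 a2 y1 y2 t01; rewrite !QfZ.
have := ler_wpM2l c0 (cu _ _ _ _ _ _ X _ a1 a2 y1 y2 t01).
by lra.
Qed.

(** Entrywise, the gap between the two sides is |u x1 - v x2|^2 / (u + v). *)
Lemma Qf_parallel_le (R : realType) n l (u v : R -> R -> R) (A : 'M[R[i]]_n)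
    (Y : 'M[R[i]]_l) X1 X2 : posdefmx A -> posdefmx Y ->
  (forall a y, 0 < a -> 0 < y -> 0 < u a y) ->
  (forall a y, 0 < a -> 0 < y -> 0 < v a y) ->
  Qf (fun a y => u a y * v a y / (u a y + v a y)) A Y (X1 + X2) (X1 + X2) <=
  Qf u A Y X1 X1 + Qf v A Y X2 X2.
Proof.
move=> pA pY u0 v0; rewrite /Qf -big_split; apply: ler_sum => i _.
rewrite -big_split; apply: ler_sum => j _; rewrite coordsD mxE /=.
have {}u0 := u0 _ _ (ev_gt0 i pA) (ev_gt0 j pY).
have {}v0 := v0 _ _ (ev_gt0 i pA) (ev_gt0 j pY).
move: (u _ _) (v _ _) u0 v0 => p q p0 q0.
case: (coords A Y X1 i j) => a b; case: (coords A Y X2 i j) => c d.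
rewrite /redot /= mulrA ler_pdivrMr ?addr_gt0//.
have : 0 <= (p * a - q * c) ^+ 2 + (p * b - q * d) ^+ 2.
  by rewrite addr_ge0 ?sqr_ge0.
by lra.
Qed.

(* The parallel sum is the infimum over X = X1 + X2 of Qf u X1 + Qf v X2,
   an infimum of jointly concave functions. *)
Lemma jconcave_parallel (R : realType) (u v : R -> R -> R) :
  (forall a y, 0 < a -> 0 < y -> 0 < u a y) ->
  (forall a y, 0 < a -> 0 < y -> 0 < v a y) ->
  jconcave u -> jconcave v ->
  jconcave (fun a y => u a y * v a y / (u a y + v a y)).
Proof.
move=> u0 v0 cu cv n l A1 A2 Y1 Y2 X t a1 a2 y1 y2 t01.
have pA := posdefmx_conv a1 a2 t01; have pY := posdefmx_conv y1 y2 t01.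
set A := RtoC t *: A1 + _ in pA *; set Y := RtoC t *: Y1 + _ in pY *.
(* The optimal splitting at the averaged point; it is reused as a competitor at both endpoints. *)
have [X1 hX1] := exists_scaled_coords A Y X (fun a y => v a y / (u a y + v a y)).
pose X2 := X - X1; have EX : X = X1 + X2 by rewrite /X2 addrC subrK.
have -> : Qf (fun a y => u a y * v a y / (u a y + v a y)) A Y X X =
          Qf u A Y X1 X1 + Qf v A Y X2 X2.
  rewrite /Qf -big_split; apply: eq_bigr => i _.
  rewrite -big_split; apply: eq_bigr => j _.
  have {}hX1 := hX1 i j.
  have hX2 : coords A Y X2 i j = coords A Y X i j - coords A Y X1 i j.
    by rewrite [in RHS]EX coordsD [X in _ = X - _]mxE [RHS]addrC addKr.
  have {}u0 := u0 _ _ (ev_gt0 i pA) (ev_gt0 j pY).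
  have {}v0 := v0 _ _ (ev_gt0 i pA) (ev_gt0 j pY).
  rewrite /= hX2 hX1; move: (u _ _) (v _ _) u0 v0 => p q p0 q0.
  case: (coords A Y X i j) => a b; rewrite /redot /= !mul0r subr0 addr0.
  by field; rewrite gt_eqF// addr_gt0.
have := cu _ _ _ _ _ _ X1 _ a1 a2 y1 y2 t01; rewrite -/A -/Y.
have := cv _ _ _ _ _ _ X2 _ a1 a2 y1 y2 t01; rewrite -/A -/Y.
have := @Qf_parallel_le _ _ _ u v _ _ X1 X2 a1 y1 u0 v0.
have := @Qf_parallel_le _ _ _ u v _ _ X1 X2 a2 y2 u0 v0.
rewrite -EX; case/andP: t01 => t0 t1 H1 H2.
have t1' : 0 <= 1 - t by lra.
have := ler_wpM2l t0 H2; have := ler_wpM2l t1' H1.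
by lra.
Qed.

(** * Limits, geometric means and Lieb's concavity *)

Lemma cvg_sumr (R : realType) (I : finType) (F : I -> nat -> R) (L : I -> R) :
  (forall i, F i k @[k --> \oo] --> L i) ->
  (\sum_i F i k) @[k --> \oo] --> \sum_i L i.
Proof.
move=> H; apply: (@cvg_big R I +%R 0 xpredT _ _ \oo _ F L _ (fun i _ => H i)).
exact: add_continuous.
Qed.

Lemma jconcave_lim (R : realType) (u_ : nat -> R -> R -> R) (u : R -> R -> R) :
  (forall k, jconcave (u_ k)) ->
  (forall a y, 0 < a -> 0 < y -> u_ k a y @[k --> \oo] --> u a y) -> jconcave u.
Proof.
move=> cu ul n l A1 A2 Y1 Y2 X t a1 a2 y1 y2 t01.
have lim (A : 'M[R[i]]_n) (Y : 'M[R[i]]_l) : posdefmx A -> posdefmx Y ->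
    Qf (u_ k) A Y X X @[k --> \oo] --> Qf u A Y X X.
  move=> pA pY; apply: cvg_sumr => i; apply: cvg_sumr => j.
  by apply: cvgMl_tmp; apply: ul; exact: ev_gt0.
apply: (@ler_cvg_to nat \oo _ _
  (fun k => t * Qf (u_ k) A1 Y1 X X + (1 - t) * Qf (u_ k) A2 Y2 X X)).
- by apply: cvgD; apply: cvgMl_tmp; exact: lim.
- by apply: lim; exact: posdefmx_conv.
- by near=> k; exact: cu.
Unshelve. all: by end_near. Qed.

(** Heron's iteration for the square root of u v. With x_k its k-th value, x_k and u v / x_k are the
    arithmetic and harmonic sequences of the arithmetic-harmonic mean. *)
Definition ahmean (R : realType) (u v : R) (k : nat) : R :=
  iter k (fun x => (x + u * v / x) / 2) u.

Lemma ahmean_gt0 (R : realType) (u v : R) k : 0 < u -> 0 < v -> 0 < ahmean u v k.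
Proof.
move=> u0 v0; elim: k => //= k IH.
by rewrite divr_gt0 ?addr_gt0 ?divr_gt0 ?mulr_gt0.
Qed.

Lemma ahmean_cvg (R : realType) (u v : R) : 0 < u -> 0 < v ->
  ahmean u v k @[k --> \oo] --> Num.sqrt (u * v).
Proof.
move=> u0 v0; set s := Num.sqrt (u * v).
have s0 : 0 < s by rewrite sqrtr_gt0 mulr_gt0.
have ss : u * v = s ^+ 2 by rewrite sqr_sqrtr// ltW// mulr_gt0.
have step k : ahmean u v k.+1 - s = (ahmean u v k - s) ^+ 2 / (2 * ahmean u v k).
  have x0 := ahmean_gt0 k u0 v0; rewrite /= -/(ahmean u v k) ss.
  by field; rewrite gt_eqF.
(* Valid only after one step, since the starting value [u] may lie below the limit; from there on
   the error at least halves. *)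
have ge k : s <= ahmean u v k.+1.
  rewrite -subr_ge0 step divr_ge0 ?sqr_ge0// mulr_ge0// ltW//; exact: ahmean_gt0.
pose c := ahmean u v 1 - s.
have le k : ahmean u v k.+1 <= s + c * 2^-1 ^+ k.
  elim: k => [|k IH]; first by rewrite expr0 mulr1 /c addrC subrK.
  have := step k.+1; have x0 := ahmean_gt0 k.+1 u0 v0.
  have : (ahmean u v k.+1 - s) ^+ 2 / (2 * ahmean u v k.+1) <=
         (ahmean u v k.+1 - s) / 2.
    move: (ahmean u v k.+1) x0 (ge k) => x x0 sx.
    by rewrite ler_pdivrMr ?mulr_gt0//; nra.
  move=> + E; rewrite -E => H.
  by rewrite -lerBlDl (le_trans H)// exprS mulrCA [leRHS]mulrC ler_pM2r// lerBlDl.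
rewrite -cvg_shiftS.
apply: (@squeeze_cvgr nat \oo _ _ (fun=> s) (fun k => s + geometric c 2^-1 k)).
- by near=> k; rewrite ge le.
- exact: cvg_cst.
- rewrite -[X in _ --> X]addr0; apply: cvgD; first exact: cvg_cst.
  by apply: cvg_geometric; rewrite ger0_norm; lra.
Unshelve. all: by end_near. Qed.

(** The two sequences are handled together: the next arithmetic term is half a sum and the next
    harmonic term is twice a parallel sum, so both stay jointly concave, and the limit is the
    geometric mean. *)
Lemma jconcave_geomean (R : realType) (u v : R -> R -> R) :
  (forall a y, 0 < a -> 0 < y -> 0 < u a y) ->
  (forall a y, 0 < a -> 0 < y -> 0 < v a y) ->
  jconcave u -> jconcave v -> jconcave (fun a y => Num.sqrt (u a y * v a y)).
Proof.
move=> u0 v0 cu cv.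
suff H k : jconcave (fun a y => ahmean (u a y) (v a y) k) /\
           jconcave (fun a y => u a y * v a y / ahmean (u a y) (v a y) k).
  apply: (@jconcave_lim _ (fun k a y => ahmean (u a y) (v a y) k)).
    by move=> k; case: (H k).
  by move=> a y a0 y0; apply: ahmean_cvg; auto.
elim: k => [|k [IH1 IH2]].
  split=> //=; apply: jconcave_ext cv => a y a0 y0.
  by rewrite [u a y * _]mulrC mulfK// gt_eqF// u0.
have pos a y : 0 < a -> 0 < y -> 0 < ahmean (u a y) (v a y) k.
  by move=> a0 y0; apply: ahmean_gt0; auto.
have half0 : (0 : R) <= 2^-1 by lra.
split.
  apply: jconcave_ext (jconcaveZ half0 (jconcaveD IH1 IH2)) => a y a0 y0 /=.
  by rewrite mulrC.
apply: jconcave_ext (jconcaveZ (ler0n _ 2) (jconcave_parallel pos _ IH1 IH2)).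
  move=> a y a0 y0 /=; rewrite -/(ahmean (u a y) (v a y) k).
  have := pos _ _ a0 y0; have := mulr_gt0 (u0 _ _ a0 y0) (v0 _ _ a0 y0).
  move: (u a y * v a y) (ahmean _ _ _) => q x q0 x0; field.
  by rewrite !gt_eqF//= addr_gt0// ?exprn_gt0// mulr_gt0.
by move=> a y a0 y0; rewrite divr_gt0 ?mulr_gt0 ?pos ?u0 ?v0.
Qed.

Lemma powR_exponent_cvg (R : realType) (a r : R) (e : nat -> R) : 0 < a ->
  e k @[k --> \oo] --> r -> a `^ e k @[k --> \oo] --> a `^ r.
Proof.
move=> a0 er; rewrite /powR gt_eqF//.
by apply: continuous_cvg; [exact: continuous_expR|exact: cvgMr_tmp].
Qed.

(* Lieb's concavity theorem, obtained by bisecting the exponent with geometric means. *)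
Lemma jconcave_powR (R : realType) (r : R) : 0 <= r <= 1 ->
  jconcave (fun a y => a `^ r * y `^ (1 - r)).
Proof.
move=> /andP[r0 r1]; pose P e := @jconcave R (fun a y => a `^ e * y `^ (1 - e)).
have P0 : P 0.
  apply: jconcave_ext (@jconcave_snd R) => a y a0 y0.
  by rewrite powRr0 mul1r subr0 powRr1// ltW.
have P1 : P 1.
  apply: jconcave_ext (@jconcave_fst R) => a y a0 y0.
  by rewrite subrr powRr0 mulr1 powRr1// ltW.
have Pmid e e' : P e -> P e' -> P ((e + e') / 2).
  move=> Pe Pe'; have pos d a y : 0 < a -> 0 < y -> 0 < a `^ d * y `^ (1 - d) :> R.
    by move=> a0 y0; rewrite mulr_gt0 ?powR_gt0.
  apply: jconcave_ext (jconcave_geomean (pos e) (pos e') Pe Pe') => a y a0 y0 /=.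
  apply/eqP; rewrite -(@eqrXn2 _ 2) ?sqrtr_ge0 ?mulr_ge0 ?powR_ge0//; apply/eqP.
  rewrite sqr_sqrtr ?mulr_ge0 ?powR_ge0// exprMn -!powR_mulrn ?powR_ge0// -!powRrM.
  rewrite divfK// mulrBl mul1r divfK// (_ : 2 - _ = (1 - e) + (1 - e')); last by ring.
  by rewrite !powRD ?(gt_eqF a0) ?(gt_eqF y0) ?implybT//; ring.
have approx k : exists2 ee : R * R, P ee.1 /\ P ee.2 &
    ee.1 <= r <= ee.2 /\ ee.2 - ee.1 <= geometric 1 2^-1 k.
  rewrite /geometric /=; elim: k => [|k [[e e'] /= [Pe Pe'] [/andP[er re'] ek]]].
    by exists (0, 1) => //=; rewrite r0 r1 expr0 mulr1 subr0.
  have Pm := Pmid _ _ Pe Pe'; rewrite exprS.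
  have [rm|mr] := leP r ((e + e') / 2).
    by exists (e, (e + e') / 2) => //=; rewrite er rm; split=> //; lra.
  by exists ((e + e') / 2, e') => //=; rewrite re' ltW//; split=> //; lra.
(* The left endpoints of the bisection intervals are admissible exponents converging to [r]. *)
have /choice[e he] : forall k, exists e, P e /\ r - geometric 1 2^-1 k <= e <= r.
  move=> k; have [[e e'] /= [Pe _] [/andP[er re'] ek]] := approx k.
  by exists e; split => //; apply/andP; split; lra.
have er : e k @[k --> \oo] --> r.
  apply: (@squeeze_cvgr nat \oo _ _ (fun k => r - geometric 1 2^-1 k) (fun=> r)).
  - by near=> k; case: (he k).
  - rewrite -[X in _ --> X]subr0; apply: cvgB; first exact: cvg_cst.
    by apply: cvg_geometric; rewrite ger0_norm; lra.
  - exact: cvg_cst.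
apply: (@jconcave_lim _ (fun k a y => a `^ e k * y `^ (1 - e k))).
  by move=> k; case: (he k).
move=> a y a0 y0; apply: cvgM; apply: powR_exponent_cvg => //.
by apply: cvgB => //; exact: cvg_cst.
Unshelve. all: by end_near. Qed.

(* Since y^2 / u = sup_w (2 y w - u w^2), the form of y^2 / u is a supremum of jointly convex functions. *)
Lemma jconcave_inv_convex (R : realType) (u : R -> R -> R) n l
    (A1 A2 : 'M[R[i]]_n) (Y1 Y2 : 'M[R[i]]_l) X t :
  (forall a y, 0 < a -> 0 < y -> 0 < u a y) -> jconcave u ->
  posdefmx A1 -> posdefmx A2 -> posdefmx Y1 -> posdefmx Y2 -> 0 <= t <= 1 ->
  Qf (fun a y => y ^+ 2 / u a y) (RtoC t *: A1 + RtoC (1 - t) *: A2)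
     (RtoC t *: Y1 + RtoC (1 - t) *: Y2) X X <=
  t * Qf (fun a y => y ^+ 2 / u a y) A1 Y1 X X +
  (1 - t) * Qf (fun a y => y ^+ 2 / u a y) A2 Y2 X X.
Proof.
move=> u0 cu a1 a2 y1 y2 t01.
have pA := posdefmx_conv a1 a2 t01; have pY := posdefmx_conv y1 y2 t01.
set A := RtoC t *: A1 + _ in pA *; set Y := RtoC t *: Y1 + _ in pY *.
(* The maximizer w = y / u at the averaged point, used as a competitor at both endpoints. *)
have [W hW] := exists_scaled_coords A Y X (fun a y => y / u a y).
have up B Z : posdefmx B -> posdefmx Z ->
    2 * Qf (fun a y => y) B Z W X - Qf u B Z W W <= Qf (fun a y => y ^+ 2 / u a y) B Z X X.
  move=> pB pZ; rewrite -QfZ /Qf -sumrB; apply: ler_sum => i _.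
  rewrite -sumrB; apply: ler_sum => j _ /=.
  have {}u0 := u0 _ _ (ev_gt0 i pB) (ev_gt0 j pZ).
  move: u0; move: (ev Z j) (u _ _) => y p p0.
  case: (coords B Z W i j) => a b; case: (coords B Z X i j) => c d.
  rewrite /redot /= [leRHS]mulrA ler_pdivlMr//.
  have : 0 <= (p * a - y * c) ^+ 2 + (p * b - y * d) ^+ 2.
    by rewrite addr_ge0 ?sqr_ge0.
  by lra.
have -> : Qf (fun a y => y ^+ 2 / u a y) A Y X X =
          2 * Qf (fun a y => y) A Y W X - Qf u A Y W W.
  rewrite -QfZ /Qf -sumrB; apply: eq_bigr => i _.
  rewrite -sumrB; apply: eq_bigr => j _ /=.
  have {}u0 := u0 _ _ (ev_gt0 i pA) (ev_gt0 j pY).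
  rewrite hW; move: u0; move: (ev Y j) (u _ _) => y p p0.
  case: (coords A Y X i j) => a b; rewrite /redot /= !mul0r subr0 addr0.
  by field; rewrite gt_eqF.
have := up _ _ a1 y1; have := up _ _ a2 y2.
rewrite !Qf_snd// /Y mulmxDr -!scalemxAr RtrD !RtrZ -/Y.
have := cu _ _ _ _ _ _ W _ a1 a2 y1 y2 t01; rewrite -/A -/Y.
case/andP: t01 => t0 t1 H0 H2 H1; have t1' : 0 <= 1 - t by lra.
have := ler_wpM2l t0 H1; have := ler_wpM2l t1' H2.
by lra.
Qed.

(** Write a^p y^(1-p) as y^2 / u, where u = a^(-p) y^(1+p) is jointly concave by Lieb's theorem with
    exponent - p in [0, 1]. *)
Lemma Ando_convexity (R : realType) n l (p : R) (A1 A2 : 'M[R[i]]_n)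
    (Y1 Y2 : 'M[R[i]]_l) (K : 'M[R[i]]_(n, l)) t :
  -1 <= p <= 0 ->
  posdefmx A1 -> posdefmx A2 -> posdefmx Y1 -> posdefmx Y2 -> 0 <= t <= 1 ->
  let T A Y := Rtr (K ^t* *m mxfun (fun x => x `^ p) A *m K
                    *m mxfun (fun x => x `^ (1 - p)) Y) in
  T (RtoC t *: A1 + RtoC (1 - t) *: A2) (RtoC t *: Y1 + RtoC (1 - t) *: Y2) <=
  t * T A1 Y1 + (1 - t) * T A2 Y2.
Proof.
move=> /andP[p1 p0] a1 a2 y1 y2 t01 /=.
pose u a y : R := a `^ (- p) * y `^ (1 - - p).
have u0 a y : 0 < a -> 0 < y -> 0 < u a y.
  by move=> a0 y0; rewrite mulr_gt0 ?powR_gt0.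
have cu : jconcave u by apply: jconcave_powR; apply/andP; split; lra.
have E a y : 0 < a -> 0 < y -> a `^ p * y `^ (1 - p) = y ^+ 2 / u a y.
  move=> a0 y0; rewrite /u invfM -!powRN opprK mulrCA; congr (_ * _).
  rewrite -powR_mulrn ?(ltW y0)// -powRD ?(gt_eqF y0) ?implybT//; congr (_ `^ _).
  by ring.
have TE A Y (pA : posdefmx A) (pY : posdefmx Y) := etrans
  (esym (Qf_trace (fun x => x `^ p) (fun x => x `^ (1 - p)) A Y K K))
  (eq_Qf K K pA pY E).
apply: (eq_convex (TE _ _ (posdefmx_conv a1 a2 t01) (posdefmx_conv y1 y2 t01))
  (TE _ _ a1 y1) (TE _ _ a2 y2)).
exact: (jconcave_inv_convex K u0 cu a1 a2 y1 y2 t01).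
Qed.

(** * Completely positive maps *)

Lemma psdmx_gram (C : numClosedFieldType) n (P : 'M[C]_n) : psdmx P ->
  exists S : 'M[C]_n, P = S ^t* *m S.
Proof.
move=> pP; exists (diag_mx (map_mx sqrtC (spectral_diag P)) *m spectralmx P).
rewrite {1}(psdmx_spectral pP) trmxC_mul !mulmxA; congr (_ *m _).
rewrite -mulmxA; congr (_ *m _); apply/matrixP => i j.
rewrite mul_mx_diag !mxE; have [->|ij] := eqVneq i j; last first.
  by rewrite !mulr0n conjC0 mul0r.
rewrite !mulr1n (CrealP _) -?expr2 ?sqrtCK// ger0_real// sqrtC_ge0.
by rewrite spectral_diag_qform.
Qed.

(** Choi's argument. The block matrix of matrix units is w^* w, hence positive, so its image under
    Phi is some S^* S. Each row of S, cut into n blocks of length l, is one Kraus operator. *)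
Lemma Kraus (C : numClosedFieldType) n l (Phi : {linear 'M[C]_n -> 'M[C]_l}) :
  completely_positive Phi ->
  exists r (K : 'I_r -> 'M[C]_(n, l)),
    forall A, Phi A = \sum_k (K k) ^t* *m A *m K k.
Proof.
move=> cp; have psdE : psdmx (\mxblock_(i < n, j < n) (delta_mx i j : 'M[C]_n)).
  pose w := \mxrow_(j < n) (delta_mx 0 j : 'rV[C]_n).
  have -> : \mxblock_(i < n, j < n) (delta_mx i j : 'M[C]_n) = w ^t* *m w.
    have -> : w ^t* = \mxcol_(i < n) (delta_mx i 0 : 'cV[C]_n).
      by rewrite tr_mxrow; apply/matrixP => i j; rewrite !mxE conjC_nat andbC.
    rewrite mul_mxcol_mxrow; apply: eq_mxblock => i j.
    by rewrite mul_delta_mx.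
  move=> v; rewrite /qform mulmxA -mulmxA -[X in _ *m X]trmxCK trmxC_mul trmxCK.
  by rewrite mxE big_ord1 !mxE mul_conjC_ge0.
have [S ES] := psdmx_gram (cp n (fun i j => delta_mx i j) psdE).
exists (\sum_(i < n) l)%N, (fun k => \matrix_(i, a) S k (tagnat.Rank i a)) => A.
have choi i j a b : Phi (delta_mx i j) a b =
    \sum_k (S k (tagnat.Rank i a))^* * S k (tagnat.Rank j b).
  have := congr1 (fun M => submxblock M i j a b) ES.
  by rewrite mxblockK => ->; rewrite !mxE; apply: eq_bigr => k _; rewrite !mxE.
rewrite {1}(matrix_sum_delta A) linear_sum; apply/matrixP => a b.
rewrite !summxE; transitivity (\sum_i \sum_j \sum_k
    A i j * ((S k (tagnat.Rank i a))^* * S k (tagnat.Rank j b))).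
  apply: eq_bigr => i _; rewrite linear_sum summxE; apply: eq_bigr => j _.
  by rewrite linearZ mxE choi mulr_sumr.
rewrite (eq_bigr _ (fun i _ => exchange_big _ _ _ _ _ _)) exchange_big /=.
apply: eq_bigr => k _; rewrite mxE exchange_big /=; apply: eq_bigr => j _.
rewrite !mxE mulr_suml; apply: eq_bigr => i _.
by rewrite !mxE; ring.
Qed.

(** The congruence by M is absorbed into the Kraus operators, which become K_k M. *)
Lemma Kraus_Ando (R : realType) n l (Phi : {linear 'M[R[i]]_n -> 'M[R[i]]_l})
    (p : R) (A1 A2 : 'M[R[i]]_n) (Y1 Y2 M : 'M[R[i]]_l) t :
  completely_positive Phi -> -1 <= p <= 0 ->
  posdefmx A1 -> posdefmx A2 -> posdefmx Y1 -> posdefmx Y2 -> 0 <= t <= 1 ->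
  let T A Y := Rtr (M ^t* *m Phi (mxfun (fun x => x `^ p) A) *m M
                    *m mxfun (fun x => x `^ (1 - p)) Y) in
  T (RtoC t *: A1 + RtoC (1 - t) *: A2) (RtoC t *: Y1 + RtoC (1 - t) *: Y2) <=
  t * T A1 Y1 + (1 - t) * T A2 Y2.
Proof.
move=> /Kraus[r [K EK]] p01 a1 a2 y1 y2 t01 /=.
have TE A Y : Rtr (M ^t* *m Phi (mxfun (fun x => x `^ p) A) *m M
    *m mxfun (fun x => x `^ (1 - p)) Y) = \sum_k Rtr ((K k *m M) ^t* *m mxfun (fun x => x `^ p) A
     *m (K k *m M) *m mxfun (fun x => x `^ (1 - p)) Y).
  rewrite EK mulmx_sumr !mulmx_suml Rtr_sum; apply: eq_bigr => k _.
  by rewrite trmxC_mul !mulmxA.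
apply: (eq_convex (TE _ _) (TE _ _) (TE _ _)).
rewrite !mulr_sumr -big_split; apply: ler_sum => k _.
exact: (Ando_convexity (K k *m M) p01 a1 a2 y1 y2 t01).
Qed.

(** * Variational formulas *)

Lemma invmx_congr (C : numClosedFieldType) n (S M : 'M[C]_n) :
  S \in unitmx -> M \in unitmx ->
  invmx (S *m M *m S) = invmx S *m invmx M *m invmx S.
Proof.
move=> uS uM; have u : S *m M *m S \in unitmx by rewrite !unitmx_mul uS uM.
apply: (can_inj (mulKmx u)); rewrite mulmxV// !mulmxA.
by rewrite mulmxK// mulmxK// mulmxV.
Qed.

Lemma Rtr_congr_inv (R : realType) n (S Z M : 'M[R[i]]_n) :
  S \in unitmx -> M \in unitmx ->
  Rtr (S *m Z *m S *m invmx (S *m M *m S)) = Rtr (Z *m invmx M).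
Proof.
move=> uS uM; rewrite (invmx_congr uS uM) !mulmxA (mulmxK uS) Rtr_mulC !mulmxA.
by rewrite (mulVmx uS) mul1mx.
Qed.

Lemma Rtr_similar (R : realType) n (T X Y : 'M[R[i]]_n) :
  T \in unitmx -> X *m T = T *m Y -> Rtr X = Rtr Y.
Proof.
move=> uT E; rewrite -(mulmxK uT X) E Rtr_mulC mulmxA.
by rewrite (mulVmx uT) mul1mx.
Qed.

Fact mxsqrt_key : unit. Proof. by []. Qed.

Definition mxsqrt (R : realType) n (A : 'M[R[i]]_n) : 'M[R[i]]_n :=
  locked_with mxsqrt_key (mxfun (fun x => Num.sqrt x) A).

Lemma mxsqrtE (R : realType) n (A : 'M[R[i]]_n) :
  mxsqrt A = mxfun (fun x => Num.sqrt x) A.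
Proof. by rewrite /mxsqrt unlock. Qed.

Lemma mxsqrt_hermitian (R : realType) n (A : 'M[R[i]]_n) : (mxsqrt A) ^t* = mxsqrt A.
Proof. by rewrite mxsqrtE mxfun_hermitian. Qed.

Lemma posdefmx_sqrt (R : realType) n (A : 'M[R[i]]_n) :
  posdefmx A -> posdefmx (mxsqrt A).
Proof.
by move=> pA; rewrite mxsqrtE; apply: posdefmx_mxfun => // x x0; rewrite sqrtr_gt0.
Qed.

Lemma mxsqrtK (R : realType) n (A : 'M[R[i]]_n) :
  posdefmx A -> mxsqrt A *m mxsqrt A = A.
Proof.
move=> pA; rewrite mxsqrtE mxfunM -[RHS](mxfun_id pA); apply: eq_mxfun => // x x0.
by rewrite -expr2 sqr_sqrtr// ltW.
Qed.

Lemma posdefmx_sqrt_congr (R : realType) n (A M : 'M[R[i]]_n) :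
  posdefmx A -> posdefmx M -> posdefmx (mxsqrt A *m M *m mxsqrt A).
Proof.
move=> pA pM; rewrite -{2}mxsqrt_hermitian; apply: posdefmx_congr => //.
exact/posdefmx_unit/posdefmx_sqrt.
Qed.

(** Lets an optimizer V be rewritten in a variable M whose linear trace term no longer involves
    A. *)
Lemma mxsqrt_congr_ex (R : realType) n (A V : 'M[R[i]]_n) :
  posdefmx A -> posdefmx V ->
  exists2 M, posdefmx M & V = mxsqrt A *m M *m mxsqrt A.
Proof.
move=> pA pV; have pS := posdefmx_sqrt pA; have uS := posdefmx_unit pS.
exists (invmx (mxsqrt A) *m V *m invmx (mxsqrt A)); last first.
  by move: uS; move: (mxsqrt A) => S uS; rewrite !mulmxA mulmxV// mul1mx mulmxKV.
rewrite -{2}(psdmx_hermitian (posdefmxW (posdefmx_inv pS))).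
by apply: posdefmx_congr => //; rewrite unitmx_inv.
Qed.

(** The matrix T = A^1/2 M^1/2 intertwines A^1/2 M A^1/2 with M^1/2 A M^1/2, hence also their images
    under g, which are therefore similar. *)
Lemma Rtr_mxfun_sqrt_swap (R : realType) n (g : R -> R) (A M : 'M[R[i]]_n) :
  posdefmx A -> posdefmx M ->
  Rtr (mxfun g (mxsqrt A *m M *m mxsqrt A)) =
  Rtr (mxfun g (mxsqrt M *m A *m mxsqrt M)).
Proof.
move=> pA pM; pose T := mxsqrt A *m mxsqrt M.
have uT : T \in unitmx.
  have uS (B : 'M[R[i]]_n) : posdefmx B -> mxsqrt B \in unitmx by move=> /posdefmx_sqrt/posdefmx_unit.
  by rewrite unitmx_mul (uS _ pA) (uS _ pM).
have E : mxsqrt A *m M *m mxsqrt A *m T = T *m (mxsqrt M *m A *m mxsqrt M).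
  have assoc (S S' B N : 'M[R[i]]_n) : S *m S = B -> S' *m S' = N ->
    S *m N *m S *m (S *m S') = S *m S' *m (S' *m B *m S').
    by move=> <- <-; rewrite !mulmxA.
  exact: assoc (mxsqrtK pA) (mxsqrtK pM).
apply: (Rtr_similar uT).
exact: mxfun_intertwine (posdefmx_sqrt_congr pA pM) (posdefmx_sqrt_congr pM pA) E.
Qed.

(** Ando's convexity at p = -1, with Z carrying the exponent -1, B the exponent 2, and the adjoints
    of the Kraus operators in the middle. *)
Lemma CP_square_inv_convex (R : realType) m l (Psi : {linear 'M[R[i]]_m -> 'M[R[i]]_l})
    (B1 B2 : 'M[R[i]]_m) (Z1 Z2 : 'M[R[i]]_l) t :
  completely_positive Psi ->
  posdefmx B1 -> posdefmx B2 -> posdefmx Z1 -> posdefmx Z2 -> 0 <= t <= 1 ->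
  let T B Z := Rtr (Psi (B *m B) *m invmx Z) in
  T (RtoC t *: B1 + RtoC (1 - t) *: B2) (RtoC t *: Z1 + RtoC (1 - t) *: Z2) <=
  t * T B1 Z1 + (1 - t) * T B2 Z2.
Proof.
move=> /Kraus[r [K EK]] b1 b2 z1 z2 t01 /=.
have TE B Z : posdefmx B -> posdefmx Z -> Rtr (Psi (B *m B) *m invmx Z) =
    \sum_k Rtr (((K k) ^t*) ^t* *m mxfun (fun x => x `^ (-1)) Z *m (K k) ^t*
                *m mxfun (fun x => x `^ (1 - -1)) B).
  move=> pB pZ; rewrite EK mulmx_suml Rtr_sum; apply: eq_bigr => k _.
  have -> : mxfun (fun x => x `^ (-1)) Z = invmx Z.
    rewrite -(mxfun_inv pZ); apply: eq_mxfun => // x x0.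
    by rewrite powR_inv1// ltW.
  have -> : mxfun (fun x => x `^ (1 - -1)) B = B *m B.
    rewrite -[in RHS](mxfun_id pB) mxfunM; apply: eq_mxfun => // x x0.
    by rewrite opprK (powR_mulrn 2) ?ltW// expr2.
  rewrite trmxCK; move: (B *m B) (K k) ((K k) ^t*) (invmx Z) => Q L L' W.
  by rewrite -[X in Rtr X = _]mulmxA Rtr_mulC !mulmxA.
apply: (eq_convex (TE _ _ (posdefmx_conv b1 b2 t01) (posdefmx_conv z1 z2 t01))
  (TE _ _ b1 z1) (TE _ _ b2 z2)).
rewrite !mulr_sumr -big_split; apply: ler_sum => k _.
by apply: Ando_convexity; first by apply/andP; split; lra.
Qed.

(** The arithmetic of a partial infimum: near-minimizers at the endpoints are averaged into a
    competitor at the middle point. *)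
Lemma partial_min_convex (R : realType) (t d F F1 F2 q q1 q2 e e1 e2 : R) :
  0 <= t <= 1 -> F <= q + e -> q1 + e1 <= F1 + d -> q2 + e2 <= F2 + d ->
  q <= t * q1 + (1 - t) * q2 -> e <= t * e1 + (1 - t) * e2 ->
  F <= t * F1 + (1 - t) * F2 + d.
Proof.
move=> /andP[t0 t1] H H1 H2 Hq He; have t1' : 0 <= 1 - t by lra.
by have := ler_wpM2l t0 H1; have := ler_wpM2l t1' H2; lra.
Qed.

Lemma eq_le_sum (R : realType) (a a' b b' c : R) :
  a = a' -> b = b' -> a <= b + c -> a' <= b' + c.
Proof. by move=> -> ->. Qed.

Lemma eq_sum_le (R : realType) (a a' b b' c d : R) :
  a = a' -> b = b' -> b + c <= a + d -> b' + c <= a' + d.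
Proof. by move=> -> ->. Qed.

(** The arithmetic of a supremum, written with negated functions: a near-maximizer of w - m at the
    middle point is a competitor at both endpoints. *)
Lemma partial_max_convex (R : realType) (t d G G1 G2 w1 w2 m m1 m2 : R) :
  0 <= t <= 1 -> - (t * w1 + (1 - t) * w2) + m <= - G + d ->
  - G1 <= - w1 + m1 -> - G2 <= - w2 + m2 ->
  - m <= t * - m1 + (1 - t) * - m2 -> G <= t * G1 + (1 - t) * G2 + d.
Proof.
move=> /andP[t0 t1] H H1 H2 Hm; have t1' : 0 <= 1 - t by lra.
by have := ler_wpM2l t0 H1; have := ler_wpM2l t1' H2; lra.
Qed.

Definition Cpow (R : realType) n l (Phi : 'M[R[i]]_n -> 'M[R[i]]_l) (p : R) A :=
  Phi (mxfun (fun x => x `^ p) A).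

Lemma posdefmx_Cpow (R : realType) n l (Phi : 'M[R[i]]_n -> 'M[R[i]]_l) (p : R) A :
  strictly_positive Phi -> posdefmx A -> posdefmx (Cpow Phi p A).
Proof.
by move=> sP pA; apply/sP/posdefmx_mxfun => // x x0; exact: powR_gt0.
Qed.

Definition sandwich (R : realType) n l (Phi : 'M[R[i]]_n -> 'M[R[i]]_l) (p : R)
    A (Z : 'M[R[i]]_l) : 'M[R[i]]_l :=
  mxsqrt (Cpow Phi p A) *m Z *m mxsqrt (Cpow Phi p A).

Lemma posdefmx_sandwich (R : realType) n l (Phi : 'M[R[i]]_n -> 'M[R[i]]_l)
    (p : R) A (Z : 'M[R[i]]_l) :
  strictly_positive Phi -> posdefmx A -> posdefmx Z -> posdefmx (sandwich Phi p A Z).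
Proof.
by move=> sP pA pZ; exact: posdefmx_sqrt_congr (posdefmx_Cpow p sP pA) pZ.
Qed.

Lemma sandwich_ex (R : realType) n l (Phi : 'M[R[i]]_n -> 'M[R[i]]_l)
    (p : R) A (V : 'M[R[i]]_l) :
  strictly_positive Phi -> posdefmx A -> posdefmx V ->
  exists2 Z, posdefmx Z & V = sandwich Phi p A Z.
Proof. by move=> sP pA pV; exact: mxsqrt_congr_ex (posdefmx_Cpow p sP pA) pV. Qed.

(** The outer factors Phi(A^p)^1/2 cancel, which removes A from the linear term of the dualities. *)
Lemma Rtr_sandwich_inv (R : realType) n l (Phi : 'M[R[i]]_n -> 'M[R[i]]_l)
    (p : R) A (Z N : 'M[R[i]]_l) :
  strictly_positive Phi -> posdefmx A -> posdefmx N ->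
  Rtr (sandwich Phi p A Z *m mxfun GRing.inv (sandwich Phi p A N)) =
  Rtr (Z *m invmx N).
Proof.
move=> sP pA pN; rewrite (mxfun_inv (posdefmx_sandwich p sP pA pN)).
apply: Rtr_congr_inv (posdefmx_unit pN).
exact: posdefmx_unit (posdefmx_sqrt (posdefmx_Cpow p sP pA)).
Qed.

(** After the swap, A enters through M^1/2 Phi(A^p) M^1/2, which is linear in Phi(A^p). The duality
    gives an infimum over Y of a term jointly convex in (A, Y) by Ando plus the convex Tr e(Y). *)
Lemma Epstein_convex (R : realType) n l (Phi : {linear 'M[R[i]]_n -> 'M[R[i]]_l})
    (p : R) (a e : R -> R) (M : 'M[R[i]]_l) (A1 A2 : 'M[R[i]]_n) t :
  strictly_positive Phi -> completely_positive Phi -> -1 <= p <= 0 ->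
  (forall x y, 0 < x -> 0 < y -> a x <= x * y `^ (1 - p) + e y) ->
  (forall x d, 0 < x -> 0 < d ->
    exists2 y, 0 < y & x * y `^ (1 - p) + e y <= a x + d) ->
  convex_pos e -> posdefmx M -> posdefmx A1 -> posdefmx A2 -> 0 <= t <= 1 ->
  Rtr (mxfun a (sandwich Phi p (RtoC t *: A1 + RtoC (1 - t) *: A2) M)) <=
  t * Rtr (mxfun a (sandwich Phi p A1 M)) +
  (1 - t) * Rtr (mxfun a (sandwich Phi p A2 M)).
Proof.
move=> sP cP p01 Y1 Y2 ce pM a1 a2 t01; have pA := posdefmx_conv a1 a2 t01.
have pV A (pA : posdefmx A) :=
  posdefmx_sqrt_congr pM (posdefmx_Cpow p sP pA).
have swap A (pA : posdefmx A) :=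
  Rtr_mxfun_sqrt_swap a (posdefmx_Cpow p sP pA) pM.
apply: (eq_convex (swap _ pA) (swap _ a1) (swap _ a2)).
apply/ler_addgt0Pr => d d0.
have [Z1 z1 H1] := Rtr_Young_attained (pV _ a1) d0 Y2.
have [Z2 z2 H2] := Rtr_Young_attained (pV _ a2) d0 Y2.
have pZ := posdefmx_conv z1 z2 t01.
have HA := Kraus_Ando (mxsqrt M) cP p01 a1 a2 z1 z2 t01.
rewrite /= mxsqrt_hermitian in HA.
apply: (partial_min_convex t01 (Rtr_Young (pV _ pA) pZ Y1) H1 H2 HA).
by apply: Rtr_convex z1 z2 t01 _ => x x0; exact: convex_pos_subgradient ce x0.
Qed.

(* Joint convexity of Tr h(C^1/2 Z C^1/2), C = Phi(A^p), is the only property of h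
   needed for the last partial minimization, over Z. *)
Definition sandwich_convex (R : realType) n l (Phi : 'M[R[i]]_n -> 'M[R[i]]_l)
    (p : R) (h : R -> R) : Prop :=
  forall A1 A2 Z1 Z2 t,
    posdefmx A1 -> posdefmx A2 -> posdefmx Z1 -> posdefmx Z2 -> 0 <= t <= 1 ->
    Rtr (mxfun h (sandwich Phi p (RtoC t *: A1 + RtoC (1 - t) *: A2)
                                 (RtoC t *: Z1 + RtoC (1 - t) *: Z2))) <=
    t * Rtr (mxfun h (sandwich Phi p A1 Z1)) +
    (1 - t) * Rtr (mxfun h (sandwich Phi p A2 Z2)).

(** A supremum over N of Tr Z N^-1, linear in Z, minus Tr m(C^1/2 N C^1/2), where C = Phi(A^p); the
    latter is concave in A. Signs are reversed throughout so that the trace dualities, stated as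
    infima, apply. *)
Lemma sandwich_convex_lt0 (R : realType) n l (Phi : {linear 'M[R[i]]_n -> 'M[R[i]]_l})
    (p : R) (h m e : R -> R) :
  strictly_positive Phi -> completely_positive Phi -> -1 <= p <= 0 ->
  (forall x v, 0 < x -> 0 < v -> x / v <= h x + m v) ->
  (forall x d, 0 < x -> 0 < d -> exists2 v, 0 < v & h x + m v <= x / v + d) ->
  (forall x y, 0 < x -> 0 < y -> - m x <= x * y `^ (1 - p) + e y) ->
  (forall x d, 0 < x -> 0 < d ->
    exists2 y, 0 < y & x * y `^ (1 - p) + e y <= - m x + d) ->
  convex_pos e -> sandwich_convex Phi p h.
Proof.
move=> sP cP p01 M1 M2 E1 E2 ce A1 A2 Z1 Z2 t a1 a2 z1 z2 t01.
have pA := posdefmx_conv a1 a2 t01; have pZ := posdefmx_conv z1 z2 t01.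
have trN g (B : 'M[R[i]]_l) : Rtr (mxfun (fun x => - g x) B) = - Rtr (mxfun g B).
  by rewrite mxfunN RtrN.
have trV B W N (pB : posdefmx B) (pN : posdefmx N) :
    Rtr (sandwich Phi p B W *m mxfun (fun v => - v^-1) (sandwich Phi p B N)) =
    - Rtr (W *m invmx N).
  by rewrite mxfunN mulmxN RtrN (Rtr_sandwich_inv _ _ sP pB pN).
apply/ler_addgt0Pr => d d0.
have M2' x d' : 0 < x -> 0 < d' -> exists2 v, 0 < v & x * - v^-1 + m v <= - h x + d'.
  by move=> x0 d'0; have [v v0 hv] := M2 x d' x0 d'0; exists v => //; lra.
have M1' x v : 0 < x -> 0 < v -> - h x <= x * - v^-1 + m v.
  by move=> x0 v0; have := M1 x v x0 v0; lra.
have [V pV H0] := Rtr_Young_attained (a := fun x => - h x)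
  (posdefmx_sandwich p sP pA pZ) d0 M2'.
(* [V] depends on the averaged A; only [N] can be carried over to A1 and A2. *)
have [N pN EV] := sandwich_ex p sP pA pV; subst V.
have H B W (pB : posdefmx B) (pW : posdefmx W) := Rtr_Young (a := fun x => - h x)
  (posdefmx_sandwich p sP pB pW) (posdefmx_sandwich p sP pB pN) M1'.
have H1 := eq_le_sum (trN _ _) (trV _ _ _ a1 pN) (H _ _ a1 z1).
have H2 := eq_le_sum (trN _ _) (trV _ _ _ a2 pN) (H _ _ a2 z2).
have HE := eq_convex (esym (trN _ _)) (esym (trN _ _)) (esym (trN _ _))
  (Epstein_convex sP cP p01 E1 E2 ce pN a1 a2 t01).
have lin : - Rtr ((RtoC t *: Z1 + RtoC (1 - t) *: Z2) *m invmx N) =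
    - (t * Rtr (Z1 *m invmx N) + (1 - t) * Rtr (Z2 *m invmx N)).
  by rewrite mulmxDl -!scalemxAl RtrD !RtrZ.
have {}H0 := eq_sum_le (trN _ _) (etrans (trV _ _ _ pA pN) lin) H0.
exact: (partial_max_convex t01 H0 H1 H2 HE).
Qed.

(** As A^0 = 1, the matrix Phi(A^0) is constant and the congruence is linear in Z. *)
Lemma sandwich_convex_eq0 (R : realType) n l (Phi : {linear 'M[R[i]]_n -> 'M[R[i]]_l})
    (h : R -> R) : strictly_positive Phi ->
  (forall x, 0 < x -> exists k, forall y, 0 < y -> h x + k * (y - x) <= h y) ->
  sandwich_convex Phi 0 h.
Proof.
move=> sP hc A1 A2 Z1 Z2 t a1 a2 z1 z2 t01.
have C1 A : posdefmx A -> Cpow Phi 0 A = Phi 1%:M.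
  move=> pA; rewrite /Cpow; congr (Phi _); rewrite -(mxfun_cst1 A).
  by apply: (eq_mxfun pA) => x x0; exact: powRr0.
have pC : posdefmx (Phi 1%:M) by rewrite -(C1 _ a1); exact: posdefmx_Cpow.
rewrite /sandwich (C1 _ a1) (C1 _ a2) (C1 _ (posdefmx_conv a1 a2 t01)).
have -> : mxsqrt (Phi 1%:M) *m (RtoC t *: Z1 + RtoC (1 - t) *: Z2) *m mxsqrt (Phi 1%:M)
  = RtoC t *: (mxsqrt (Phi 1%:M) *m Z1 *m mxsqrt (Phi 1%:M)) +
    RtoC (1 - t) *: (mxsqrt (Phi 1%:M) *m Z2 *m mxsqrt (Phi 1%:M)).
  by rewrite mulmxDr mulmxDl -!scalemxAr -!scalemxAl.
exact: Rtr_convex (posdefmx_sqrt_congr pC z1) (posdefmx_sqrt_congr pC z2) t01 hc.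
Qed.

(** * Joint convexity of the trace function *)

Lemma trace_funE (R : realType) n m l (f : R -> R) (p : R)
    (Phi : 'M[R[i]]_n -> 'M[R[i]]_l) (Psi : 'M[R[i]]_m -> 'M[R[i]]_l) A B :
  trace_fun f p Phi Psi A B = Rtr (mxfun f (sandwich Phi p A (Psi (B *m B)))).
Proof. by rewrite /sandwich mxsqrtE. Qed.

Lemma posdefmx_square (R : realType) n (B : 'M[R[i]]_n) :
  posdefmx B -> posdefmx (B *m B).
Proof.
move=> pB; rewrite (_ : B *m B = mxfun id B *m mxfun id B); last by rewrite mxfun_id.
by rewrite mxfunM; apply: (posdefmx_mxfun pB) => x x0; rewrite mulr_gt0.
Qed.

(** The first duality presents the trace function as an infimum over Z of two terms, jointly convex
    in (B, Z) and in (A, Z). *)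
Lemma trace_fun_convex (R : realType) n m l (Phi : {linear 'M[R[i]]_n -> 'M[R[i]]_l})
    (Psi : {linear 'M[R[i]]_m -> 'M[R[i]]_l}) (p : R) (f h : R -> R)
    (A1 A2 : 'M[R[i]]_n) (B1 B2 : 'M[R[i]]_m) t :
  strictly_positive Phi -> strictly_positive Psi -> completely_positive Psi ->
  (forall s x, 0 < s -> 0 < x -> f s <= s / x + h x) ->
  (forall s d, 0 < s -> 0 < d -> exists2 x, 0 < x & s / x + h x <= f s + d) ->
  sandwich_convex Phi p h ->
  posdefmx A1 -> posdefmx A2 -> posdefmx B1 -> posdefmx B2 -> 0 <= t <= 1 ->
  trace_fun f p Phi Psi (RtoC t *: A1 + RtoC (1 - t) *: A2)
                        (RtoC t *: B1 + RtoC (1 - t) *: B2)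
  <= t * trace_fun f p Phi Psi A1 B1 + (1 - t) * trace_fun f p Phi Psi A2 B2.
Proof.
move=> sP sQ cQ H1 H2 cG a1 a2 b1 b2 t01.
have pX A B (pA : posdefmx A) (pB : posdefmx B) :=
  posdefmx_sandwich p sP pA (sQ _ (posdefmx_square pB)).
have opt A B d : posdefmx A -> posdefmx B -> 0 < d -> exists2 Z, posdefmx Z &
    Rtr (Psi (B *m B) *m invmx Z) + Rtr (mxfun h (sandwich Phi p A Z)) <=
    trace_fun f p Phi Psi A B + d.
  move=> pA pB d0.
  have [W pW HW] := Rtr_Young_attained (th := GRing.inv) (pX _ _ pA pB) d0 H2.
  have [Z pZ EW] := sandwich_ex p sP pA pW; exists Z; first exact: pZ.
  subst W; apply: eq_sum_le (Rtr_sandwich_inv _ _ sP pA pZ) HW.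
  by rewrite trace_funE.
have pA := posdefmx_conv a1 a2 t01; have pB := posdefmx_conv b1 b2 t01.
apply/ler_addgt0Pr => d d0.
have [Z1 z1 K1] := opt _ _ _ a1 b1 d0; have [Z2 z2 K2] := opt _ _ _ a2 b2 d0.
have pZ := posdefmx_conv z1 z2 t01.
have K := Rtr_Young (th := GRing.inv) (pX _ _ pA pB) (posdefmx_sandwich p sP pA pZ) H1.
have {}K := eq_le_sum (esym (trace_funE _ _ _ _ _ _))
  (Rtr_sandwich_inv _ _ sP pA pZ) K.
exact: (partial_min_convex t01 K K1 K2 (CP_square_inv_convex cQ b1 b2 z1 z2 t01)
  (cG _ _ _ _ _ a1 a2 z1 z2 t01)).
Qed.

Local Close Scope sesquilinear_scope.

Theorem theorem5p6 (R : realType) (n m l : nat)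
  (Phi : {linear 'M[R[i]]_n -> 'M[R[i]]_l})
  (Psi : {linear 'M[R[i]]_m -> 'M[R[i]]_l})
  (p : R) (f : R -> R) :
  strictly_positive Phi -> completely_positive Phi ->
  strictly_positive Psi -> completely_positive Psi ->
  -1 <= p <= 0 ->
  (* f non-decreasing on (0, oo) *)
  (forall x y : R, 0 < x -> x <= y -> f x <= f y) ->
  (* f concave on (0, oo) *)
  (forall (x y t : R), 0 < x -> 0 < y -> 0 <= t <= 1 ->
     t * f x + (1 - t) * f y <= f (t * x + (1 - t) * y)) ->
  (* lim_{x -> oo} f(x)/x = 0 *)
  ((fun x => f x / x) @ +oo --> (0 : R)) ->
  (* x |-> f(x^(2+p)) convex on (0, oo) *)
  (forall (x y t : R), 0 < x -> 0 < y -> 0 <= t <= 1 ->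
     f ((t * x + (1 - t) * y) `^ (2 + p))
       <= t * f (x `^ (2 + p)) + (1 - t) * f (y `^ (2 + p))) ->
  (* joint convexity on P_n x P_m *)
  forall (A1 A2 : 'M[R[i]]_n) (B1 B2 : 'M[R[i]]_m) (t : R),
    posdefmx A1 -> posdefmx A2 -> posdefmx B1 -> posdefmx B2 ->
    0 <= t <= 1 ->
    trace_fun f p Phi Psi (RtoC t *: A1 + RtoC (1 - t) *: A2)
                          (RtoC t *: B1 + RtoC (1 - t) *: B2)
    <= t * trace_fun f p Phi Psi A1 B1 + (1 - t) * trace_fun f p Phi Psi A2 B2.
Proof.
move=> sP cP sQ cQ /andP[p1 p0] fm fconc fl fg A1 A2 B1 B2 t a1 a2 b1 b2 t01.
have fc : convex_pos (fun x => - f x).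
  by move=> x y s x0 y0 s01; have := fconc x y s x0 y0 s01; lra.
have [fcst|[{}p1 [x [y [x0 xy fxy]]]]] := constant_or_gtN1 p1 fm fl fg.
  (* For constant f the trace does not depend on A and B. *)
  have E A B : posdefmx A -> posdefmx B ->
      trace_fun f p Phi Psi A B = \sum_(i < l) f 1.
    move=> pA pB; rewrite trace_funE Rtr_mxfun; apply: eq_bigr => i _.
    apply: fcst; last exact: ltr01.
    exact: (ev_gt0 i (posdefmx_sandwich p sP pA (sQ _ (posdefmx_square pB)))).
  rewrite (E _ _ a1 b1) (E _ _ a2 b2).
  by rewrite (E _ _ (posdefmx_conv a1 a2 t01) (posdefmx_conv b1 b2 t01)); lra.
have y0 : 0 < y by lra.
have h1 := fun s x => @hdual_ge R f s x fm fl.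
have h2 := fun s d => @hdual_attained R f s d fm fc.
have hm x' y' := @hdual_nondecreasing R f x' y' fm fl.
have p10 : -1 < p <= 0 by rewrite p1.
have hc := hdual_powR_convex p10 fm fl fg.
have a01 : 0 < 1 + p <= 1 by apply/andP; split; lra.
have hsub z (z0 : 0 < z) := convex_powR_subgradient a01 hm hc z0.
suff : sandwich_convex Phi p (hdual f).
  by move=> cG; exact: trace_fun_convex sP sQ cQ h1 h2 cG a1 a2 b1 b2 t01.
(* The case p = 0 is separate because the superlinearity argument needs an exponent 1 + p < 1. *)
have [ep|pn0] := eqVneq p 0.
  subst p; apply: sandwich_convex_eq0 => // z z0.
  by have [k _ hk] := hsub z z0; exists k.
have pl0 : p < 0 by rewrite lt_neqAle pn0.
have hs : superlinear (hdual f).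
  move=> c c0; apply: convex_powR_superlinear hc _ c0; first by apply/andP; split; lra.
  have [z [w [z0 w0 zw]]] := hdual_nonconstant fm fc fl x0 y0 fxy.
  (* Monotonicity of [hdual f] puts the two points with different values in increasing order. *)
  exists z, w; split=> //; rewrite ltNge; apply/negP => wz.
  by have := hm _ _ w0 wz; lra.
have p11 : -1 < p < 0 by rewrite p1.
apply: (@sandwich_convex_lt0 _ _ _ _ _ _ (mdual (hdual f)) (edual (mdual (hdual f)) p)) => //.
- by rewrite p0 ltW.
- by move=> z v; exact: mdual_ge.
- by move=> z d z0; apply: mdual_attained => //; exact: hsub.
- by move=> z v z0 _; exact: edual_ge.
- by move=> z d; apply: edual_attained => //; lra.
- apply: (@edual_convex _ _ _ (hdual f 1)) => //.
    by move=> z v; exact: edual_bound.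
  exact: mdual_powR_convex.
Qed.
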